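(* Let $G$ be a connected cubic graph with cyclic connectivity $\zeta(G)=5$, and let $H$ be a cyclic part of $G$. If $H$ is not a cycle of length $5$, then $H$ can be extended to a cyclically $5$-connected cubic graph by adding three new vertices on a path of length two and by restoring $3$-regularity; that is, the five vertices of degree $2$ of $H$ can be ordered as $a_1,a_2,a_3,a_4,a_5$ in such a way that the cubic graph $H(a_1,a_2,a_3,a_4,a_5)$ is cyclically $5$-connected.
   Context: Graphs are finite; cubic graphs may a priori contain loops and parallel edges. An edge-cut of a connected graph $G$ is a set $S$ of edges such that $G-S$ is disconnected; it is cycle-separating if at least two components of $G-S$ contain a cycle. A connected graph $G$ is cyclically $k$-connected (equivalently, cyclically $k$-edge-connected) if it contains no cycle-separating edge-cut with fewer than $k$ edges. The cyclic connectivity $\zeta(G)$ is the largest integer $k\le |E(G)|-|V(G)|+1$ for which $G$ is cyclically $k$-connected. If $S$ is a cycle-separating edge-cut of minimum size in a cubic graph $G$, then $S$ consists of pairwise independent edges and $G-S$ has exactly two components; these components are called cyclic parts of $G$. In particular, if $\zeta(G)=5$, then such a cut has $5$ edges and a cyclic part $H$ of $G$ has exactly five vertices of degree $2$, all its other vertices having degree $3$ in $H$. For a cyclic part $H$ of a cubic graph $G$ with $\zeta(G)=5$ and an ordering $a_1,\dots,a_5$ of its five vertices of degree $2$, $H(a_1,a_2,a_3,a_4,a_5)$ denotes the cubic graph obtained from $H$ by adding three new vertices $x,y,z$ and the edges $xy$, $yz$, $xa_1$, $xa_2$, $ya_3$, $za_4$, $za_5$. *)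

(* Defs.v *)
From mathcomp Require Import all_boot.

Set Implicit Arguments.
Unset Strict Implicit.
Unset Printing Implicit Defensive.

(* Finite graphs with loops and parallel edges allowed. The orientation of an
   edge given by src and tgt is only a device for naming its two ends: none of
   the notions below depends on it. *)
Record mgraph := MGraph {
  vertex :> finType;
  edge : finType;
  src : edge -> vertex;
  tgt : edge -> vertex
}.

(* A loop contributes 2. *)
Definition deg (G : mgraph) (v : G) : nat :=
  #|[set e : edge G | src e == v]| + #|[set e : edge G | tgt e == v]|.

Definition cubic (G : mgraph) : Prop := forall v : G, deg v = 3.

Definition adj (G : mgraph) : rel G := fun u v =>
  [exists e : edge G, ((src e == u) && (tgt e == v))
                   || ((src e == v) && (tgt e == u))].

Definition connected (G : mgraph) : Prop :=
  0 < #|G| /\ forall u v : G, connect (@adj G) u v.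

Definition dart (G : mgraph) : Type := (edge G * bool)%type.

Definition dart_from (G : mgraph) (d : dart G) : G :=
  if d.2 then tgt d.1 else src d.1.

Definition dart_to (G : mgraph) (d : dart G) : G :=
  if d.2 then src d.1 else tgt d.1.

(* Closed walks without repeated vertices or edges; a loop is a cycle of
   length 1, two parallel edges form a cycle of length 2. *)
Definition is_cycle (G : mgraph) (c : seq (dart G)) : Prop :=
  [/\ 0 < size c,
      cycle (fun d d' => dart_to d == dart_from d') c,
      uniq (map (@dart_from G) c)
    & uniq (map fst c)].

Definition has_cycle (G : mgraph) : Prop := exists c : seq (dart G), is_cycle c.

Definition is_cycle_graph (G : mgraph) (n : nat) : Prop :=
  exists c : seq (dart G),
    [/\ is_cycle c, size c = n,
        forall v : G, v \in map (@dart_from G) c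
      & forall e : edge G, e \in map fst c].

Definition del_edges (G : mgraph) (S : {set edge G}) : mgraph :=
  @MGraph G {e : edge G | e \notin S}
    (fun e => src (val e)) (fun e => tgt (val e)).

Definition induced (G : mgraph) (A : {set G}) : mgraph :=
  @MGraph {v : G | v \in A}
    {e : edge G | (src e \in A) && (tgt e \in A)}
    (fun e => exist _ (src (val e)) (proj1 (andP (valP e))))
    (fun e => exist _ (tgt (val e)) (proj2 (andP (valP e)))).

Definition component (G : mgraph) (x : G) : mgraph :=
  induced [set y : G | connect (@adj G) x y].

Definition edge_cut (G : mgraph) (S : {set edge G}) : Prop :=
  ~ connected (del_edges S).

Definition cycle_separating (G : mgraph) (S : {set edge G}) : Prop :=
  edge_cut S /\
  exists x y : del_edges S,
    [/\ ~~ connect (@adj (del_edges S)) x y,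
        has_cycle (component x) & has_cycle (component y)].

Definition cyclically_connected (G : mgraph) (k : nat) : Prop :=
  connected G /\
  forall S : {set edge G}, cycle_separating S -> ~ (#|S| < k).

(* The bound k <= |E| - |V| + 1, written without truncated subtraction. *)
Definition cyclic_connectivity_candidate (G : mgraph) (k : nat) : Prop :=
  k + #|G| <= #|edge G| + 1 /\ cyclically_connected G k.

Definition cyclic_connectivity_is (G : mgraph) (k : nat) : Prop :=
  cyclic_connectivity_candidate G k /\
  forall k', cyclic_connectivity_candidate G k' -> k' <= k.

Definition min_cycle_separating (G : mgraph) (S : {set edge G}) : Prop :=
  cycle_separating S /\
  forall S' : {set edge G}, cycle_separating S' -> #|S| <= #|S'|.

Definition cyclic_part (G H : mgraph) : Prop :=
  exists S : {set edge G}, min_cycle_separating S /\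
  exists x : del_edges S, H = component x.

(* The new vertices x, y, z are the elements 0, 1, 2 of 'I_3. *)
Section Extension.
Variables (H : mgraph) (a1 a2 a3 a4 a5 : H).

Let x : H + 'I_3 := inr (@Ordinal 3 0 isT).
Let y : H + 'I_3 := inr (@Ordinal 3 1 isT).
Let z : H + 'I_3 := inr (@Ordinal 3 2 isT).

Definition new_ends : 7.-tuple ((H + 'I_3) * (H + 'I_3)) :=
  [tuple (x, y); (y, z); (x, inl a1); (x, inl a2); (y, inl a3);
         (z, inl a4); (z, inl a5)].

Definition extension : mgraph :=
  @MGraph (H + 'I_3)%type (edge H + 'I_7)%type
    (fun e => match e with
              | inl e' => inl (src e')
              | inr i => (tnth new_ends i).1
              end)
    (fun e => match e with
              | inl e' => inl (tgt e')
              | inr i => (tnth new_ends i).2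
              end).
End Extension.

(* Main.v *)
Require Import Defs.
From mathcomp Require Import all_boot zify.

Set Implicit Arguments.
Unset Strict Implicit.
Unset Printing Implicit Defensive.

(** The whole argument counts edges.  For a vertex set X of a cubic graph G let
    f(X) be the number of edges leaving X and e(X) the number of edges inside;
    then f(X) = 3|X| - 2e(X).  A set that contains a cycle contains a
    nonempty C with e(C) >= |C|, and conversely, so cyclic connectivity becomes
    a statement about f and e alone: G is cyclically k-connected iff it is
    connected and f(X) >= k whenever X and its complement are both cyclic
    (boundary_cycle_separating, cyclically_connectedI).

    Since zeta(G) = 5 a minimum cycle-separating cut has exactly 5 edges and is
    the boundary of the part H (min_cut_card5, min_cut_comp_set).  What H
    inherits is recorded in the predicate pole: for X inside H the number
    3|X| - 2e(X) is at least 5 if X is cyclic, and it is 5 for X = H.  Here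
    3|X| - 2e(X) = f(X) + t(X), where f(X) now counts edges of H leaving X and
    t(X) counts the terminals in X, that is, the vertices of degree 2; there
    are 5 of them.  A set with f(X) + t(X) <= 4 is acyclic, hence has at most
    two vertices (small_boundary); this is the fact used throughout.

    Let x, y, z be the new vertices.  A cycle-separating cut of the extension
    with fewer than 5 edges can, after complementing and discarding new
    vertices with at most one neighbour on their side, only come from a set U
    of vertices of H that contains both neighbours p, q of x (or of z).
    Counting shows that then either U meets the terminals exactly in p and q
    and f(U) <= 3, or all but two terminals lie in U and the complement of U is
    an edge joining the last two.  So it suffices to find two disjoint pairs of
    terminals for which neither happens (good_pair); their elements
    become the neighbours of x and of z, and the fifth terminal goes to y.

    Finding the pairs.  If two terminals a, b are adjacent, then no further
    terminal is adjacent to a or b, as otherwise H would be a 5-cycle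
    (terminal_nbr_unique); if U spoils {a, c}, then removing a from U does not
    increase f, so U has three vertices and a and c have a common neighbour
    (pinched_linked).  As there are no cycles of length at most 4, few pairs
    are spoilt.  If no two terminals are adjacent, sub- and posimodularity of f
    show that of two spoilt pairs sharing a terminal one is spoilt by a set of
    three vertices (pinched_adjacent_pairs), and then that in a triangle of
    spoilt pairs any two terminals have a common neighbour (pinched_triangle).
    Were there no two disjoint good pairs, the spoilt pairs would contain a
    complete graph on four terminals or all pairs meeting a fixed pair, and
    too many common neighbours would force a cycle of length 4. *)

(** * Edge counts *)

Definition inner (G : mgraph) (X : {set G}) : {set edge G} :=
  [set e | (src e \in X) && (tgt e \in X)].

Definition boundary (G : mgraph) (X : {set G}) : {set edge G} :=
  [set e | (src e \in X) != (tgt e \in X)].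

(** A set containing a cycle contains a C with at least as many edges as
    vertices, and conversely (cyclic_set_cycle); this form is stable under the
    counting arguments below, which never see an actual cycle. *)
Definition cyclic_set (G : mgraph) (X : {set G}) : Prop :=
  exists2 C : {set G}, C \subset X & 0 < #|C| <= #|inner C|.

Lemma card_set_sum (T : finType) (P : pred T) : #|[set e | P e]| = \sum_e (P e : nat).
Proof. by rewrite -sum1_card -big_mkcond /=; apply: eq_bigl => e; rewrite inE. Qed.

Section EdgeCounts.
Variable G : mgraph.
Implicit Types (X Y C : {set G}) (v w : G).

(** Each edge contributes to the degree sum over X once for each of its ends in X. *)
Lemma handshake X :
  \sum_(v in X) deg v = #|inner X|.*2 + #|boundary X|.
Proof.
have -> : \sum_(v in X) deg v = \sum_(e : edge G) ((src e \in X) + (tgt e \in X)).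
  rewrite /deg.
  under eq_bigr => v _ do rewrite !card_set_sum -big_split /=.
  rewrite exchange_big /=; apply: eq_bigr => e _; rewrite big_split /=.
  have S (u : G) : \sum_(v in X) (u == v : nat) = (u \in X).
    case: (boolP (u \in X)) => uX.
      rewrite (bigD1 u) //= eqxx big1 // => v /andP[_ /negbTE].
      by rewrite eq_sym => ->.
    rewrite big1 // => v vX; case: eqP => // uv.
    by rewrite uv vX in uX.
  by rewrite !S.
rewrite /inner /boundary !card_set_sum -mul2n big_distrr -big_split /=.
by apply: eq_bigr => e _; do 2 case: (_ \in X).
Qed.

Lemma boundaryC X : boundary (~: X) = boundary X.
Proof. by apply/setP=> e; rewrite !inE; do 2 case: (_ \in X). Qed.

(** Both inequalities hold edge by edge, whatever the position of the two ends. *)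
Lemma boundary_submodular X Y :
  #|boundary (X :&: Y)| + #|boundary (X :|: Y)| <= #|boundary X| + #|boundary Y|.
Proof.
rewrite /boundary !card_set_sum -!big_split /=; apply: leq_sum => e _; rewrite !inE.
by do 2 case: (_ \in X); do 2 case: (_ \in Y).
Qed.

Lemma boundary_posimodular X Y :
  #|boundary (X :\: Y)| + #|boundary (Y :\: X)| <= #|boundary X| + #|boundary Y|.
Proof.
rewrite /boundary !card_set_sum -!big_split /=; apply: leq_sum => e _; rewrite !inE.
by do 2 case: (_ \in X); do 2 case: (_ \in Y).
Qed.

Lemma innerS X Y : X \subset Y -> inner X \subset inner Y.
Proof.
move=> sXY; apply/subsetP=> e; rewrite !inE => /andP[s t].
by rewrite !(subsetP sXY).
Qed.

Lemma cyclic_setS X Y : X \subset Y -> cyclic_set X -> cyclic_set Y.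
Proof. by move=> sXY [C sCX HC]; exists C => //; apply: subset_trans sXY. Qed.

Lemma adjC v w : adj v w = adj w v.
Proof.
by rewrite /adj; apply: eq_existsb => e; rewrite orbC.
Qed.

(** Distinct neighbours of v are reached by distinct edges, whence an inequality
    that remains true with parallel edges. *)
Lemma inner_nbrs X v : v \notin X ->
  #|inner X| + #|[set x in X | adj v x]| <= #|inner (v |: X)|.
Proof.
move=> vX; rewrite -(cardsID (inner X) (inner (v |: X))).
rewrite (setIidPr _) ?innerS ?subsetUr // leq_add2l.
apply: leq_trans (leq_imset_card (fun e => if src e == v then tgt e else src e) _).
apply: subset_leq_card; apply/subsetP=> x; rewrite inE => /andP[xX /existsP[e He]].
have xv : (x == v) = false by apply: contraNF vX => /eqP <-.
apply/imsetP; exists e.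
  rewrite !inE; case/orP: He => /andP[/eqP-> /eqP->];
  by rewrite !eqxx xX (negbTE vX) ?orbT ?andbF.
by case/orP: He => /andP[/eqP-> /eqP->]; rewrite ?eqxx // xv.
Qed.

Lemma card_nbrs_deg v : #|[set w | adj v w]| <= deg v.
Proof.
apply: leq_trans (leq_add (leq_imset_card (@tgt G) _) (leq_imset_card (@src G) _)).
apply: leq_trans (leq_card_setU _ _).
apply: subset_leq_card; apply/subsetP=> w; rewrite inE => /existsP[e].
case/orP=> /andP[/eqP s /eqP t]; rewrite inE; apply/orP; [left|right];
by apply/imsetP; exists e; rewrite ?inE ?s ?t.
Qed.

Lemma inner_D1 C v :
  #|inner C| <= #|inner (C :\ v)| + #|[set e in inner C | (src e == v) || (tgt e == v)]|.
Proof.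
rewrite -(cardsID (inner (C :\ v)) (inner C)); apply: leq_add.
  by rewrite subset_leq_card // subsetIr.
apply: subset_leq_card; apply/subsetP=> e; rewrite !inE.
by do 2 case: (_ == v); do 2 case: (_ \in C).
Qed.

(** No cycle runs through a vertex that has at most one edge inside X: removing it
    costs C one vertex and at most one edge. *)
Lemma cyclic_setD1 X v :
    #|[set e in inner X | (src e == v) || (tgt e == v)]| <= 1 ->
    inner [set v] = set0 ->
  cyclic_set X -> cyclic_set (X :\ v).
Proof.
move=> le1 nl [C sCX /andP[C0 leC]].
have [vC|vC] := boolP (v \in C); last first.
  exists C; last by rewrite C0.
  by apply/subsetP=> w wC; rewrite !inE (subsetP sCX) // andbT; apply: contraNneq vC => <-.
exists (C :\ v); first by apply: setSD.
have le2 : #|[set e in inner C | (src e == v) || (tgt e == v)]| <= 1.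
  apply: leq_trans le1; apply: subset_leq_card; apply/subsetP=> e.
  by rewrite !inE => /andP[/andP[a b] ->]; rewrite !(subsetP sCX).
have := inner_D1 C v; have := cardsD1 v C; rewrite vC => Ecard leD.
have pos : 0 < #|C :\ v|.
  rewrite lt0n; apply: contraTneq leC => /eqP; rewrite cards_eq0 => /eqP Cv.
  suff -> : C = [set v] by rewrite nl cards1 cards0.
  by rewrite -(setD1K vC) Cv setU0.
by rewrite pos; lia.
Qed.

End EdgeCounts.

(** * Cycles and cyclic sets *)

Lemma mem_split (T : eqType) (x : T) s : x \in s -> exists p1 p2, s = p1 ++ x :: p2.
Proof. by case/splitPr=> p1 p2; exists p1, p2. Qed.

Section Cycles.
Variable G : mgraph.
Implicit Types (X Y C : {set G}) (v w : G) (d : dart G).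

Lemma is_cycle_inner (c : seq (dart G)) : is_cycle c ->
  [set e in map fst c] \subset inner [set v in map (@dart_from G) c].
Proof.
case=> _ cyc _ _; apply/subsetP=> e; rewrite !inE => /mapP[d dc ->].
have Hf : dart_from d \in map (@dart_from G) c by apply: map_f.
have Ht : dart_to d \in map (@dart_from G) c.
  have /eqP -> := next_cycle cyc dc.
  by apply: map_f; rewrite mem_next.
by move: Hf Ht; rewrite /dart_from /dart_to; case: (d.2) => -> ->.
Qed.

Lemma is_cycle_card (c : seq (dart G)) : is_cycle c ->
  let C := [set v in map (@dart_from G) c] in #|C| = size c /\ 0 < #|C| <= #|inner C|.
Proof.
move=> cyc C; have [c0 _ uV uE] := cyc.
have cardC : #|C| = size c.
  by rewrite cardsE (card_uniqP uV) size_map.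
have cardE : #|[set e in map fst c]| = size c.
  by rewrite cardsE (card_uniqP uE) size_map.
split=> //; rewrite cardC c0 -cardE.
by apply: subset_leq_card; apply: is_cycle_inner.
Qed.

Definition tour_step : rel (dart G) := fun d d' => dart_to d == dart_from d'.

(** A walk that never turns back on the edge just used can be prolonged as long as
    every vertex of C has two edges inside C.  Either it hits an earlier
    vertex, and closes a cycle, or its vertices stay distinct.  Distinctness
    of the edges is carried along so that the closed part is a cycle as it
    stands. *)
Lemma extend_walk C (n : nat) :
    C != set0 ->
    (forall v, v \in C ->
       1 < #|[set e in inner C | (src e == v) || (tgt e == v)]|) ->
  (exists2 c, is_cycle c & {subset map fst c <= inner C}) \/
  exists d t, [/\ size t = n, sorted tour_step (d :: t),
     uniq (map (@dart_from G) (d :: t)), uniq (map fst (d :: t)) &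
     {subset map fst (d :: t) <= inner C}].
Proof.
move=> /set0Pn[v0 v0C] deg2.
have next_dart v (e0 : edge G) : v \in C ->
    exists d, [/\ dart_from d = v, d.1 != e0 & d.1 \in inner C].
  move=> /deg2; rewrite (cardsD1 e0) => H.
  have /set0Pn[e] : [set e in inner C | (src e == v) || (tgt e == v)] :\ e0 != set0.
    by rewrite -card_gt0; case: (_ \in _) H => /=; lia.
  rewrite 4!inE => /andP[ne /andP[ein /orP[/eqP sv|/eqP tv]]].
    by exists (e, false); split=> //; rewrite inE.
  by exists (e, true); split=> //; rewrite inE.
elim: n => [|n [|[d [t [st so uV uE sub]]]]]; [| by left |].
  have /set0Pn[e] : [set e in inner C | (src e == v0) || (tgt e == v0)] != set0.
    by rewrite -card_gt0; have := deg2 _ v0C; lia.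
  rewrite inE => /andP[ein _]; right; exists (e, false), [::]; split=> //.
  by move=> e'; rewrite inE => /eqP ->.
set l := last d t; set v := dart_to l.
have lt : l \in d :: t by apply: mem_last.
have vC : v \in C.
  have := sub _ (map_f fst lt); rewrite inE => /andP[].
  by rewrite /v /dart_to; case: (l.2).
have [d' [fd' nd' ind']] := next_dart v l.1 vC.
have [vt|vt] := boolP (v \in map (@dart_from G) (d :: t)).
  left; case/mapP: vt => dj djt vdj.
  have [p1 [p2 Edef]] := mem_split djt.
  exists (dj :: p2); last first.
    by move=> e He; apply: sub; rewrite Edef map_cat mem_cat He orbT.
  have lE : l = last dj p2 by rewrite /l (_ : last d t = last d (d :: t)) // Edef last_cat.
  split=> //.
  - move: so; rewrite Edef => /cat_sorted2[_ /= so].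
    by rewrite rcons_path so /= -lE -/v vdj.
  - by move: uV; rewrite Edef map_cat cat_uniq => /and3P[].
  - by move: uE; rewrite Edef map_cat cat_uniq => /and3P[].
right; exists d, (rcons t d').
(* an edge used before has both ends among the vertices left so far, except for
   the last edge, which next_dart avoids *)
have nE : d'.1 \notin map fst (d :: t).
  apply: contra vt => /mapP[di dit Ei].
  have : (v == dart_from di) || (v == dart_to di).
    rewrite -fd' /dart_from /dart_to Ei.
    by do 2 case: (_.2); rewrite eqxx ?orbT.
  case/orP=> /eqP ->; first exact: map_f.
  have nl : di != l by apply: contraNneq nd' => <-; rewrite Ei.
  have [p1 [[|d2 p2] Edef]] := mem_split dit.
    by case/eqP: nl; rewrite /l (_ : last d t = last d (d :: t)) // Edef last_cat.
  move: so; rewrite Edef => /cat_sorted2[_ /= /andP[/eqP -> _]].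
  by rewrite map_cat mem_cat /= !inE eqxx !orbT.
rewrite -rcons_cons !map_rcons !rcons_uniq nE fd' vt uV uE size_rcons st; split=> //.
- by rewrite /= rcons_path -/l; move: so => /= ->; rewrite /tour_step fd' eqxx.
- move=> e; rewrite mem_rcons inE => /orP[/eqP-> //|]; exact: sub.
Qed.

(** Discard vertices with at most one edge inside C until none is left; loops are
    cycles by themselves, and otherwise a long enough walk must close up. *)
Lemma cyclic_set_cycle X : cyclic_set X ->
  exists2 c, is_cycle c & {subset map fst c <= inner X}.
Proof.
move: {2}_.+1 (ltnSn #|X|) => n; elim: n X => // n IH X leX [C sCX /andP[C0 leC]].
suff [c cyc sub] : exists2 c, is_cycle c & {subset map fst c <= inner C}.
  by exists c => // e /sub; apply: (subsetP (innerS sCX)).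
have [/existsP[e /andP[ein /eqP lp]]|/existsPn nolp] :=
  boolP [exists e in inner C, src e == tgt e].
  exists [:: (e, false)]; last by move=> e'; rewrite inE => /eqP ->.
  by split; rewrite //= /dart_to /dart_from /= lp eqxx.
have [/existsP[v /andP[vC lev]]|/existsPn deg2] :=
  boolP [exists v in C, #|[set e in inner C | (src e == v) || (tgt e == v)]| <= 1].
  have [c cyc sub] : exists2 c, is_cycle c & {subset map fst c <= inner (C :\ v)}.
    apply: IH.
      have := cardsD1 v C; rewrite vC; have := subset_leq_card sCX; lia.
    apply: cyclic_setD1 lev _ _; last by exists C; rewrite ?C0.
    apply/setP=> e; rewrite !inE; apply/negP=> /andP[/eqP se /eqP te].
    by have := nolp e; rewrite inE se te vC eqxx.
  by exists c => // e /sub; apply: (subsetP (innerS (subD1set _ _))).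
have [| |//|[d [t [st _ uV _ _]]]] := @extend_walk C #|G|.
- by rewrite -card_gt0.
- by move=> v vC; have := deg2 v; rewrite vC /= -ltnNge.
have := card_uniqP uV; have := max_card (mem (map (@dart_from G) (d :: t))).
by rewrite size_map /= st => H1 H2; move: H1; rewrite H2 ltnn.
Qed.

End Cycles.

(** * Subgraphs and separating cuts *)

Definition embedding (F G : mgraph) (phi : F -> G) (psi : edge F -> edge G) : Prop :=
  [/\ injective phi, injective psi,
      forall e, src (psi e) = phi (src e) & forall e, tgt (psi e) = phi (tgt e)].

Section Embedding.
Variables (F G : mgraph) (phi : F -> G) (psi : edge F -> edge G).
Hypothesis emb : embedding phi psi.

Lemma inner_embedding (X : {set F}) : psi @: inner X \subset inner (phi @: X).
Proof.
have [_ _ hs ht] := emb; apply/subsetP=> _ /imsetP[e + ->].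
by rewrite !inE hs ht => /andP[sX tX]; rewrite !imset_f.
Qed.

Lemma cyclic_set_embedding (X : {set F}) : cyclic_set X -> cyclic_set (phi @: X).
Proof.
have [ip iq _ _] := emb; case=> C sCX /andP[C0 leC].
exists (phi @: C); first exact: imsetS.
rewrite card_imset // C0 (leq_trans leC) // -(card_imset _ iq).
exact: subset_leq_card (inner_embedding C).
Qed.

Lemma has_cycle_embedding (c : seq (dart G)) :
  is_cycle c -> {subset map fst c <= codom psi} -> has_cycle F.
Proof.
have [ip iq hs ht] := emb => cyc sub.
pose h (d : dart F) : dart G := (psi d.1, d.2).
have [c' Ec] : exists c', map h c' = c.
  elim: c sub {cyc} => [|[e b] c IH] sub; first by exists [::].
  have [|c' <-] := IH; first by move=> f Hf; apply: sub; rewrite inE Hf orbT.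
  have /codomP[e' ->] := sub e (mem_head _ _).
  by exists ((e', b) :: c').
exists c'; have hf d : dart_from (h d) = phi (dart_from d).
  by rewrite /dart_from /=; case: ifP.
have hto d : dart_to (h d) = phi (dart_to d).
  by rewrite /dart_to /=; case: ifP.
move: cyc; rewrite -Ec => -[]; rewrite size_map -!map_comp cycle_map => s0 cy uV uE.
split=> //.
- by rewrite (eq_cycle (e' := relpre h (fun d d' => dart_to d == dart_from d'))) // => d d' /=;
  rewrite hf hto (inj_eq ip).
- by rewrite -(map_inj_uniq ip) -map_comp -(eq_map hf).
- by rewrite -(map_inj_uniq iq) -map_comp.
Qed.

End Embedding.

Section Separation.
Variable G : mgraph.
Implicit Types (S : {set edge G}) (X : {set G}).

(** Reading a component of the graph without S as a vertex set of G gives it a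
    boundary in G. *)
Definition comp_set S (x : G) : {set G} :=
  [set y : G | connect (@adj (del_edges S)) x y].

Lemma component_embedding S (x : del_edges S) :
  @embedding (component x) G (fun v => val v) (fun e => val (val e)).
Proof.
split=> // [|e f /val_inj/val_inj //]; exact: val_inj.
Qed.

Lemma component_image S (x : del_edges S) :
  [set (val v : G) | v in [set: component x]] = comp_set S x.
Proof.
apply/setP=> y; apply/imsetP/idP=> [[v _ ->]|yx].
  by have := valP v; rewrite !inE.
have yx' : y \in [set y : del_edges S | connect (@adj (del_edges S)) x y].
  by move: yx; rewrite !inE.
by exists (exist _ y yx').
Qed.

Lemma cyclic_comp_set S (x : del_edges S) :
  has_cycle (component x) -> cyclic_set (comp_set S x).
Proof.
case=> c cyc; rewrite -component_image.
apply: cyclic_set_embedding (component_embedding x) _ _.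
have [_ H] := is_cycle_card cyc; eexists; last exact: H.
exact: subsetT.
Qed.

Lemma adj_del_edges S (e : edge G) : e \notin S -> @adj (del_edges S) (src e) (tgt e).
Proof.
by move=> eS; apply/existsP; exists (exist _ e eS); rewrite !eqxx.
Qed.

Lemma boundary_comp_set S (x : G) : boundary (comp_set S x) \subset S.
Proof.
apply/subsetP=> e; rewrite !inE; apply: contraNT => eS; apply/eqP.
have A := adj_del_edges eS.
have A' : @adj (del_edges S) (tgt e) (src e) by rewrite adjC.
by apply/idP/idP=> H; apply: connect_trans H (connect1 _).
Qed.

(** The edges of a cycle avoiding S connect all its vertices in the graph without S,
    so the cycle lies in one component. *)
Lemma component_has_cycle S (c : seq (dart G)) : is_cycle c ->
    {in map fst c, forall e, e \notin S} ->
  exists2 x : del_edges S, x \in map (@dart_from G) c & has_cycle (component x).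
Proof.
move=> cyc nS; have [c0 cy _ _] := cyc.
case: c => // d c in cyc nS c0 cy *.
exists (dart_from d : del_edges S); first exact: mem_head.
apply: (has_cycle_embedding (component_embedding (dart_from d : del_edges S)) cyc) => e ec.
have eS := nS _ ec.
have cyA : cycle (@adj (del_edges S)) (map (@dart_from G) (d :: c)).
  rewrite cycle_map; apply: sub_in_cycle cy => // d1 d2 d1c _ /= /eqP <-.
  have A := adj_del_edges (nS _ (map_f fst d1c)).
  by rewrite /dart_from /dart_to; case: (d1.2); rewrite // adjC.
have conn y : y \in map (@dart_from G) (d :: c) ->
  y \in [set y : del_edges S | connect (@adj (del_edges S)) (dart_from d) y].
  by move=> yc; rewrite inE; apply: (connect_cycle cyA) => //; apply: mem_head.
have /subsetP/(_ e) := is_cycle_inner cyc; rewrite !inE => /(_ ec)/andP[sc tc].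
have He : (@src (del_edges S) (exist _ e eS) \in
    [set y : del_edges S | connect (@adj (del_edges S)) (dart_from d) y]) &&
  (@tgt (del_edges S) (exist _ e eS) \in
    [set y : del_edges S | connect (@adj (del_edges S)) (dart_from d) y]).
  by rewrite /= !conn.
by apply/codomP; exists (exist _ (exist _ e eS) He).
Qed.

(** Together with cyclically_connectedI this reduces cyclic connectivity to
    boundaries of vertex sets, with no reference to components. *)
Lemma boundary_cycle_separating X :
  cyclic_set X -> cyclic_set (~: X) -> cycle_separating (boundary X).
Proof.
have main Y : boundary Y = boundary X -> cyclic_set Y ->
    exists2 x : del_edges (boundary X), (x : G) \in Y & has_cycle (component x).
  move=> EY /cyclic_set_cycle[c cyc sub].
  have [|x xc cx] := @component_has_cycle (boundary X) c cyc.
    move=> e /sub; rewrite -EY !inE => /andP[-> ->]; by [].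
  exists x => //; have /mapP[d dc ->] := xc.
  have := sub _ (map_f fst dc); rewrite inE => /andP[].
  by rewrite /dart_from; case: (d.2).
move=> /(main _ erefl)[x xX cx] /(main _ (boundaryC X))[y yX cy].
have nxy : ~~ connect (@adj (del_edges (boundary X))) x y.
  have clX : closed (@adj (del_edges (boundary X))) (mem X).
    move=> u v /existsP[e]; have := valP e; rewrite inE negbK => /eqP E.
    by case/orP=> /andP[/eqP <- /eqP <-]; [exact: E | exact: esym E].
  apply/negP=> /(closed_connect clX) E; rewrite inE in yX.
  have {}E : (x \in X) = (y \in X) := E.
  by rewrite -E xX in yX.
split; last by exists x, y.
by case=> _ /(_ x y); rewrite (negbTE nxy).
Qed.

Lemma cyclically_connected_boundary k X : cyclically_connected G k ->
  cyclic_set X -> cyclic_set (~: X) -> k <= #|boundary X|.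
Proof.
case=> _ H cX cY; rewrite leqNgt; apply/negP.
by apply: H; apply: boundary_cycle_separating.
Qed.

Lemma comp_set_disjoint S (x y : del_edges S) :
  ~~ connect (@adj (del_edges S)) x y -> comp_set S y \subset ~: comp_set S x.
Proof.
move=> nxy; apply/subsetP=> z; rewrite !inE => yz.
apply: contra nxy => xz; apply: connect_trans xz _.
by rewrite (sym_connect_sym (@adjC (del_edges S))).
Qed.

Lemma cycle_separating_comp_set S : cycle_separating S ->
  exists x y : G, let X := comp_set S x in let Y := comp_set S y in
  [/\ cyclic_set X, cyclic_set Y, Y \subset ~: X, x \in X & y \in Y].
Proof.
case=> _ [x [y [nxy cx cy]]]; exists x, y; split; try exact: cyclic_comp_set.
- exact: comp_set_disjoint.
- by rewrite inE connect0.
- by rewrite inE connect0.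
Qed.

(** The boundary of a component of the graph without S consists of edges of S. *)
Lemma cyclically_connectedI k : connected G ->
    (forall X, cyclic_set X -> cyclic_set (~: X) -> k <= #|boundary X|) ->
  cyclically_connected G k.
Proof.
move=> conn H; split=> // S /cycle_separating_comp_set[x [y [cX cY sYX _ _]]] ltS.
have := H _ cX (cyclic_setS sYX cY).
by have := subset_leq_card (boundary_comp_set S x); lia.
Qed.

Lemma boundary_connected X : connected G -> boundary X = set0 -> X != set0 -> X = setT.
Proof.
case=> _ conn b0 /set0Pn[x xX]; apply/setP=> y; rewrite inE.
have cl : closed (@adj G) (mem X).
  move=> u v /existsP[e]; move/setP/(_ e): b0; rewrite !inE => /negbFE/eqP E.
  by case/orP=> /andP[/eqP <- /eqP <-]; [exact: E | exact: esym E].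
have E : (x \in X) = (y \in X) := closed_connect cl (conn x y).
by rewrite -E.
Qed.

End Separation.

(** * What a cyclic part inherits *)

Section CyclicPart.
Variable G : mgraph.
Implicit Types (S : {set edge G}) (X : {set G}).

Lemma boundaryT : boundary [set: G] = set0.
Proof. by apply/setP=> e; rewrite !inE. Qed.

Lemma innerT : inner [set: G] = setT.
Proof. by apply/setP=> e; rewrite !inE. Qed.

Lemma cubic_handshake X : cubic G -> 3 * #|X| = #|inner X|.*2 + #|boundary X|.
Proof.
move=> cub; rewrite -handshake (eq_bigr (fun=> 3)) => [|v _]; last exact: cub.
by rewrite sum_nat_const mulnC.
Qed.

(** Let X and Y be the two cyclic components given by cycle_separating.  By minimality S
    is the boundary of X and also the boundary of Y, so every edge of S joins
    X to Y.  A third component would have no leaving edge at all,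
    contradicting connectedness; so any component is X or Y. *)
Lemma min_cut_comp_set S (x : G) : connected G -> min_cycle_separating S ->
  let A := comp_set S x in [/\ S = boundary A, cyclic_set A & cyclic_set (~: A)].
Proof.
move=> conn [sep min] A.
have [u [v]] := cycle_separating_comp_set sep.
set X := comp_set S u; set Y := comp_set S v; case=> cX cY sYX uX vY.
have sXY : X \subset ~: Y by rewrite subsetC.
have bnd Z : boundary Z \subset S -> cyclic_set Z -> cyclic_set (~: Z) -> S = boundary Z.
  move=> sZ cZ cZ'; apply/eqP; rewrite eq_sym eqEcard sZ.
  by apply: min; apply: boundary_cycle_separating.
have SX : S = boundary X.
  by apply: bnd (boundary_comp_set _ _) cX _; apply: cyclic_setS cY.
have SY : S = boundary Y.
  by apply: bnd (boundary_comp_set _ _) cY _; apply: cyclic_setS cX.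
have comp_eq w : x \in comp_set S w -> A = comp_set S w.
  rewrite inE => wx; apply/setP=> y; rewrite !inE.
  by rewrite (same_connect (sym_connect_sym (@adjC (del_edges S))) wx).
have [xX|xX] := boolP (x \in X).
  by rewrite (comp_eq _ xX); split=> //; apply: cyclic_setS cY.
have [xY|xY] := boolP (x \in Y).
  by rewrite (comp_eq _ xY); split=> //; apply: cyclic_setS cX.
have disj w : x \notin comp_set S w -> forall y, y \in A -> y \notin comp_set S w.
  move=> nx y; rewrite inE => xy; apply: contra nx; rewrite !inE => wy.
  apply: connect_trans wy _; by rewrite (sym_connect_sym (@adjC (del_edges S))).
have xA : x \in A by rewrite inE connect0.
suff AT : A = setT by move: (disj _ xX u); rewrite AT inE uX => /(_ isT).
apply: boundary_connected => //; last by apply/set0Pn; exists x.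
apply/setP=> e; rewrite [RHS]inE; apply/negP=> eA.
have eS : e \in S := subsetP (boundary_comp_set S x) e eA.
have eX : e \in boundary X by rewrite -SX.
have eY : e \in boundary Y by rewrite -SY.
have dX := disj _ xX; have dY := disj _ xY.
have dXY y : y \in Y -> y \notin X by move=> /(subsetP sYX); rewrite inE.
move: eA eX eY; rewrite /boundary 3!inE.
move: (dX (src e)) (dX (tgt e)) (dY (src e)) (dY (tgt e)) (dXY (src e)) (dXY (tgt e)).
rewrite -/X -/Y.
case: (src e \in A); case: (tgt e \in A); case: (src e \in X); case: (tgt e \in X);
case: (src e \in Y); case: (tgt e \in Y) => //= h1 h2 h3 h4 h5 h6;
by [have := h1 isT | have := h2 isT | have := h3 isT | have := h4 isT | have := h5 isT | have := h6 isT].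
Qed.

(** If all cycle-separating cuts had 6 or more edges, maximality of 5 would leave only
    the bound on |E| - |V| + 1, that is, at most 8 vertices; but a cyclic set C
    with |C| <= |inner C| has 5 <= |boundary C| <= |C|, so there are at least 5
    vertices on each side. *)
Lemma min_cut_card5 S : connected G -> cubic G -> cyclic_connectivity_is G 5 ->
  min_cycle_separating S -> #|S| = 5.
Proof.
move=> conn cub [[_ cc5] max5] mS; have [sep min] := mS.
have ge5 : 5 <= #|S|.
  by rewrite leqNgt; apply/negP; have [_ H] := cc5; apply: H.
apply/eqP; rewrite eqn_leq ge5 andbT leqNgt; apply/negP => gt5.
have [x _] := cycle_separating_comp_set sep.
have [_ cA cB] := min_cut_comp_set x conn mS.
set A := comp_set S x in cA cB.
have big X : cyclic_set X -> cyclic_set (~: X) -> 5 <= #|X|.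
  move=> [C sCX /andP[C0 leC]] cX.
  have cC : cyclic_set C by exists C; rewrite ?C0.
  have cC' : cyclic_set (~: C) by apply: cyclic_setS cX; rewrite setCS.
  have := cyclically_connected_boundary cc5 cC cC'.
  have := cubic_handshake C cub; have := subset_leq_card sCX; lia.
have A5 := big _ cA cB; have B5 := big _ cB; rewrite setCK in B5.
suff /max5 : cyclic_connectivity_candidate G 6 by []. split.
  have := cubic_handshake setT cub; rewrite boundaryT innerT cards0 !cardsT.
  by have := B5 cA; have := cardsC A; lia.
split=> // S' sep' lt6; have := min _ sep'; lia.
Qed.

End CyclicPart.

(** For a set X of vertices of H, the number 3|X| - 2|inner X| counts the edges of the
    cubic graph G that leave X.  Thus pole_card says that five edges leave H, and
    pole_sparse that at least five leave any cyclic set. *)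
Record pole (H : mgraph) : Prop := Pole {
  pole_deg : forall v : H, deg v <= 3;
  pole_card : #|edge H|.*2 + 5 = 3 * #|H|;
  pole_sparse : forall X : {set H}, cyclic_set X -> #|inner X|.*2 + 5 <= 3 * #|X|;
  pole_cyclic : cyclic_set [set: H]
}.

Lemma deg_embedding F G phi psi : @embedding F G phi psi ->
  forall v, deg v <= deg (phi v).
Proof.
case=> ip iq hs ht v; apply: leq_add; rewrite -(card_imset _ iq);
apply: subset_leq_card; apply/subsetP=> _ /imsetP[e + ->];
by rewrite !inE ?hs ?ht => /eqP ->.
Qed.

(** H is an induced subgraph of G because its boundary is all of S, so edges inside a set
    may be counted in either graph; and the other side of the cut is cyclic,
    so each cyclic set of vertices of H has a cyclic complement in G. *)
Lemma cyclic_part_pole (G H : mgraph) : connected G -> cubic G ->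
  cyclic_connectivity_is G 5 -> cyclic_part G H -> pole H.
Proof.
move=> conn cub zeta [S [mS [x ->]]].
have S5 := min_cut_card5 conn cub zeta mS.
have [SA cA cB] := @min_cut_comp_set G S x conn mS.
have [[_ cc5] _] := zeta.
set A := comp_set S x in SA cA cB *; set H' := component x.
pose phi (v : H') : G := val v; pose psi (e : edge H') : edge G := val (val e).
have emb : embedding phi psi := component_embedding x.
have im : phi @: [set: H'] = A := component_image x.
have [ip iq hs ht] := emb.
have full (X : {set H'}) : #|inner X| = #|inner (phi @: X)|.
  rewrite -(card_imset _ iq); suff -> : psi @: inner X = inner (phi @: X) by [].
  apply/eqP; rewrite eqEsubset; apply/andP; split.
    exact: inner_embedding.
  apply/subsetP=> e; rewrite inE => /andP[/imsetP[u uX su] /imsetP[v vX tv]].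
  have eS : e \notin S.
    by rewrite SA inE negbK su tv -im !imset_f ?inE.
  have He : (@src (del_edges S) (exist _ e eS) \in
      [set y : del_edges S | connect (@adj (del_edges S)) x y]) &&
    (@tgt (del_edges S) (exist _ e eS) \in
      [set y : del_edges S | connect (@adj (del_edges S)) x y]).
    by rewrite /= su tv (valP u) (valP v).
  apply/imsetP; exists (exist _ (exist _ e eS) He) => //.
  rewrite inE; apply/andP; split.
    by rewrite -(mem_imset _ _ ip) -hs; apply/imsetP; exists u.
  by rewrite -(mem_imset _ _ ip) -ht; apply/imsetP; exists v.
have sA (X : {set H'}) : phi @: X \subset A.
  by rewrite -im; apply: imsetS; apply: subsetT.
split.
- by move=> v; rewrite -(cub (phi v)); apply: (deg_embedding emb).
- have := cubic_handshake A cub; rewrite -SA S5 -im -full innerT cardsT.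
  by rewrite card_imset // cardsT => ->.
- move=> X cX; have cX' := cyclic_set_embedding emb cX.
  have cY : cyclic_set (~: (phi @: X)) by apply: cyclic_setS cB; rewrite setCS.
  have := cyclically_connected_boundary cc5 cX' cY.
  by have := cubic_handshake (phi @: X) cub; rewrite -full card_imset //; lia.
- have [C sCA HC] := cA; exists (phi @^-1: C); first exact: subsetT.
  have <- : #|phi @: (phi @^-1: C)| = #|phi @^-1: C| by rewrite card_imset.
  rewrite full; suff -> : phi @: (phi @^-1: C) = C by [].
  apply/setP=> v; apply/imsetP/idP=> [[u + ->]|vC]; first by rewrite inE.
  have := subsetP sCA v vC; rewrite -im => /imsetP[u _ Ev].
  by exists u; rewrite ?inE -?Ev.
Qed.

(** * Counting in a pole *)

Definition terminals (H : mgraph) : {set H} := [set v | deg v == 2].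

(** Joining p and q to a new vertex x creates a small cut around U together with x:
    its edges are those of the boundary of U and the one from x to y. *)
Definition pinched (H : mgraph) (p q : H) : bool :=
  [exists U : {set H}, (U :&: terminals H == [set p; q]) && (#|boundary U| <= 3)].

(** The second clause excludes the other source of small cuts: if s and t are adjacent
    terminals outside the pair, they form a short cycle with the new vertices
    other than the neighbour of p and q, and few edges leave that cycle. *)
Definition good_pair (H : mgraph) (p q : H) : Prop :=
  ~~ pinched p q /\
  forall s t, s \in terminals H -> t \in terminals H -> adj s t ->
    (s \in [:: p; q]) || (t \in [:: p; q]).

(** The typical pinching set has three vertices: p, q and a common neighbour. *)
Definition linked (H : mgraph) (p q : H) : bool :=
  [exists m, [&& m \notin terminals H, adj p m & adj q m]].

Section Pole.
Variable H : mgraph.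
Hypothesis HP : pole H.
Implicit Types (X U W : {set H}) (p q r s t m n v : H).
Local Notation T := (terminals H).

(** There are no cycles of length at most 4, in particular no loops and no parallel
    edges: a set with |inner X| >= |X| would satisfy 2|X| + 5 <= 3|X|. *)
Lemma sparse_small X : 0 < #|X| <= 4 -> #|inner X| < #|X|.
Proof.
case/andP=> X0 X4; rewrite ltnNge; apply/negP => leX.
suff : #|inner X|.*2 + 5 <= 3 * #|X| by lia.
by apply: (pole_sparse HP); exists X; rewrite ?X0.
Qed.

Lemma inner1 v : inner [set v] = set0.
Proof.
by apply/eqP; rewrite -cards_eq0; have := @sparse_small [set v]; rewrite cards1 => /(_ isT); lia.
Qed.

Lemma adj_irr v : adj v v = false.
Proof.
apply/negbTE/negP=> /existsP[e He]; have := in_set0 e; rewrite -(inner1 v) !inE.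
by case/orP: He => /andP[-> ->].
Qed.

Lemma adj_neq v w : adj v w -> v != w.
Proof. by apply: contraTneq => ->; rewrite adj_irr. Qed.

Lemma card_edges_at v :
  #|[set e : edge H | (src e == v) || (tgt e == v)]| <= deg v.
Proof.
rewrite /deg; apply: leq_trans (leq_card_setU _ _).
by apply: subset_leq_card; apply/subsetP=> e; rewrite !inE.
Qed.

(** A vertex of degree at most 1 could be removed without destroying cycles, leaving a
    cyclic set with at most 3 * |H| - 3 - 2 * (|E| - 1) = 4 edges leaving it. *)
Lemma deg_ge2 v : 2 <= deg v.
Proof.
rewrite leqNgt; apply/negP=> d1.
have le1 : #|[set e in inner [set: H] | (src e == v) || (tgt e == v)]| <= 1.
  rewrite -ltnS; apply: leq_ltn_trans d1; apply: leq_trans (card_edges_at v).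
  by apply: subset_leq_card; apply/subsetP=> e; rewrite !inE.
have := pole_sparse HP (cyclic_setD1 le1 (inner1 v) (pole_cyclic HP)).
have := inner_D1 setT v; rewrite innerT cardsT.
have := cardsD1 v [set: H]; rewrite inE cardsT => E1.
have := pole_card HP; rewrite innerT in le1; lia.
Qed.

Lemma pole_count X : 3 * #|X| = #|inner X|.*2 + #|boundary X| + #|X :&: T|.
Proof.
rewrite -handshake.
have -> : #|X :&: T| = \sum_(v in X) (v \in T).
  rewrite -sum1_card -big_mkcondr /=; apply: eq_bigl => v; by rewrite inE.
rewrite -big_split /= (eq_bigr (fun=> 3)) ?sum_nat_const 1?mulnC // => v _.
by rewrite inE; have := deg_ge2 v; have := pole_deg HP v; case: eqP => /=; lia.
Qed.

Lemma card_terminals : #|T| = 5.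
Proof.
have := pole_count setT; rewrite boundaryT innerT cards0 !cardsT setTI.
by have := pole_card HP; lia.
Qed.

Lemma card_compl_terminals X : #|~: X :&: T| = 5 - #|X :&: T|.
Proof.
have := cardsID X T; rewrite [T :&: X]setIC setDE [T :&: ~: X]setIC card_terminals; lia.
Qed.

(** With at most 4 edges leaving, X is not cyclic, so |inner X| < |X| and
    |X| + 2 <= 3|X| - 2|inner X| <= 4. *)
Lemma small_boundary X : #|boundary X| + #|X :&: T| <= 4 -> #|X| <= 2.
Proof.
have := pole_count X => E le4.
have [X0|] := posnP #|X|; first by rewrite X0.
case: (ltnP #|inner X| #|X|) => [|le X0]; first by lia.
have := @pole_sparse _ HP X; suff cX : cyclic_set X by move=> /(_ cX); lia.
by exists X; rewrite ?X0.
Qed.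

Lemma boundary_ge3 X : X != set0 -> 3 <= #|boundary X| + #|X :&: T|.
Proof.
rewrite -card_gt0 => X0; rewrite leqNgt; apply/negP=> lt3.
have := @small_boundary X; have := @sparse_small X; rewrite X0.
by have := pole_count X; lia.
Qed.

Lemma inner_add1 X (v x : H) : v \notin X -> x \in X -> adj v x ->
  #|inner X| + 1 <= #|inner (v |: X)|.
Proof.
move=> vX xX vx; apply: leq_trans (inner_nbrs vX); rewrite leq_add2l card_gt0.
by apply/set0Pn; exists x; rewrite inE xX.
Qed.

Lemma inner_add2 X (v x y : H) : v \notin X -> x \in X -> y \in X -> x != y ->
  adj v x -> adj v y -> #|inner X| + 2 <= #|inner (v |: X)|.
Proof.
move=> vX xX yX xy vx vy; apply: leq_trans (inner_nbrs vX); rewrite leq_add2l.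
apply: leq_trans (_ : #|[set x; y]| <= _); first by rewrite cards2 xy.
apply: subset_leq_card; apply/subsetP=> z; rewrite !inE.
by case/orP=> /eqP ->; rewrite ?xX ?yX.
Qed.

Lemma inner_isolated X v : {in X, forall w, ~~ adj v w} -> #|inner X| <= #|inner (X :\ v)|.
Proof.
move=> iso; apply: leq_trans (inner_D1 X v) _.
rewrite (_ : [set _ in _ | _] = set0) ?cards0 ?addn0 //; apply/setP=> e.
rewrite !inE; apply/negP=> /andP[/andP[sX tX]].
case/orP=> /eqP ev; move: (iso _ sX) (iso _ tX); rewrite -ev; last rewrite [X in ~~ X]adjC;
by [move=> _ /existsPn/(_ e); rewrite !eqxx | move=> /existsPn/(_ e); rewrite !eqxx].
Qed.

Lemma inner2 p q : p != q -> 0 < #|inner [set p; q]| -> adj p q.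
Proof.
move=> pq pos; apply: contraLR pos => npq; rewrite lt0n negbK.
have : #|inner [set p; q]| <= #|inner ([set p; q] :\ p)|.
  by apply: inner_isolated => w; rewrite !inE => /orP[] /eqP ->; rewrite ?adj_irr.
rewrite (_ : _ :\ p = [set q]) ?inner1 ?cards0 ?leqn0 //.
by apply/setP=> v; rewrite !inE; case: eqP => //= ->; rewrite (negbTE pq).
Qed.

Lemma no_triangle (a b c : H) : adj a b -> adj b c -> adj a c -> False.
Proof.
move=> ab bc ac.
have [[nab nbc] nac] := (adj_neq ab, adj_neq bc, adj_neq ac).
have aX : a \notin b |: [set c] by rewrite !inE negb_or nab.
have bX : b \notin [set c] by rewrite inE.
have := inner_add1 bX (set11 c) bc.
have := inner_add2 aX (setU11 _ _) (setU1r _ (set11 c)) nbc ab ac.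
have := @sparse_small (a |: (b |: [set c])).
by rewrite !cardsU1 aX bX cards1 /= => /(_ isT); lia.
Qed.

Lemma no_4cycle p q m n : adj p m -> adj p n -> adj q m -> adj q n -> p != q -> m != n -> False.
Proof.
move=> pm pn qm qn pq mn.
have [[[h1 h2] h3] h4] := (adj_neq pm, adj_neq pn, adj_neq qm, adj_neq qn).
have mX : m \notin [set p] by rewrite inE eq_sym.
have qX : q \notin m |: [set p] by rewrite !inE negb_or h3 eq_sym.
have nX : n \notin q |: (m |: [set p]).
  by rewrite !inE !negb_or [n == q]eq_sym [n == m]eq_sym [n == p]eq_sym h4 mn.
have mp : adj m p by rewrite adjC.
have np : adj n p by rewrite adjC.
have nq : adj n q by rewrite adjC.
have := inner_add1 mX (set11 p) mp.
have := inner_add1 qX (setU11 _ _) qm.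
have := inner_add2 nX (setU1r _ (setU1r _ (set11 p))) (setU11 _ _) pq np nq.
have c4 : #|n |: (q |: (m |: [set p]))| = 4 by rewrite cardsU1 nX cardsU1 qX cardsU1 mX cards1.
have := @sparse_small (n |: (q |: (m |: [set p]))); rewrite c4 => /(_ isT).
by clear; lia.
Qed.

Lemma nbrs_bound v (l : seq H) : uniq l -> all (adj v) l -> size l <= deg v.
Proof.
move=> /card_uniqP <- /allP al; apply: leq_trans (card_nbrs_deg v).
by apply: subset_leq_card; apply/subsetP=> w /al; rewrite inE.
Qed.

Lemma four_nbrs (v w x y z : H) : uniq [:: w; x; y; z] ->
  adj v w -> adj v x -> adj v y -> adj v z -> False.
Proof.
move=> u a b c d; have := nbrs_bound (v := v) u; rewrite /= a b c d => /(_ isT).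
by have := pole_deg HP v; lia.
Qed.

Lemma terminal_nbrs (v x y z : H) : v \in T -> adj v x -> adj v y -> adj v z ->
  [|| x == y, x == z | y == z].
Proof.
rewrite inE => /eqP d2 a b c; apply: contraT; rewrite !negb_or => /and3P[xy xz yz].
have := @nbrs_bound v [:: x; y; z]; rewrite /= !inE negb_or xy xz yz a b c d2.
by move=> /(_ isT isT).
Qed.

Lemma linkedP p q : reflect (exists m, [/\ m \notin T, adj p m & adj q m]) (linked p q).
Proof. by apply: (iffP existsP) => -[m] => [/and3P|] H'; exists m => //; apply/and3P. Qed.

Lemma linkedC p q : linked p q = linked q p.
Proof. by apply: eq_existsb => m; congr (_ && _); rewrite andbC. Qed.

Lemma pinchedC p q : pinched p q = pinched q p.
Proof. by apply: eq_existsb => U; rewrite setUC. Qed.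

(** Counting gives one inner edge if U = {p, q} and two if U = {p, q, m}; as p and q
    are not adjacent, the latter two edges join m to p and to q. *)
Lemma linked_of_small U p q : p != q -> ~~ adj p q -> U :&: T = [set p; q] ->
  #|boundary U| <= 3 -> #|U| <= 3 -> linked p q.
Proof.
move=> pq npq UT le3 U3.
have /setIP[pU pT] : p \in U :&: T by rewrite UT !inE eqxx.
have /setIP[qU qT] : q \in U :&: T by rewrite UT !inE eqxx orbT.
have := pole_count U; rewrite UT cards2 pq => cnt.
have E1 := cardsD1 p U; have E2 := cardsD1 q (U :\ p).
rewrite pU in E1; rewrite !inE eq_sym pq qU in E2.
case: (posnP #|U :\ p :\ q|) => [/eqP|].
  rewrite cards_eq0 => /eqP E0; case/negP: npq; apply: inner2 => //.
  suff <- : U = [set p; q] by lia.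
  by rewrite -(setD1K pU) -(setD1K (a := q) (A := U :\ p)) ?E0 ?setU0 // !inE eq_sym pq.
move=> pos; have /cards1P[m Em] : #|U :\ p :\ q| == 1 by lia.
have EU : U = p |: (q |: [set m]).
  by rewrite -(setD1K pU) -(setD1K (a := q) (A := U :\ p)) ?Em // !inE eq_sym pq.
have : m \in U :\ p :\ q by rewrite Em set11.
rewrite !inE => /and3P[mq mp mU].
have in2 : 2 <= #|inner U| by lia.
apply/linkedP; exists m; split.
- apply/negP=> mT; have : m \in U :&: T by rewrite inE mU mT.
  by rewrite UT !inE (negbTE mp) (negbTE mq).
- apply: contraLR in2 => npm; rewrite -ltnNge.
  have iso : {in U, forall w, ~~ adj p w}.
    by move=> w; rewrite EU !inE => /or3P[]/eqP-> //; rewrite adj_irr.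
  apply: leq_ltn_trans (inner_isolated iso) _.
  rewrite EU setU1K ?inE ?negb_or ?pq 1?eq_sym ?mp //.
  have := @sparse_small (q |: [set m]).
  by rewrite cardsU1 cards1 inE [q == m]eq_sym mq => /(_ isT).
- apply: contraLR in2 => nqm; rewrite -ltnNge.
  have iso : {in U, forall w, ~~ adj q w}.
    by move=> w; rewrite EU !inE => /or3P[]/eqP-> //; rewrite ?adj_irr // adjC.
  apply: leq_ltn_trans (inner_isolated iso) _.
  rewrite (_ : U :\ q = p |: [set m]); last first.
    apply/setP=> w; rewrite EU !inE; case: (w =P q) => //= ->.
    by rewrite eq_sym (negbTE pq) eq_sym (negbTE mq).
  have := @sparse_small (p |: [set m]).
  by rewrite cardsU1 cards1 inE [p == m]eq_sym mp => /(_ isT).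
Qed.

End Pole.

(** * Good pairs when two terminals are adjacent *)

Section Pairing.
Variable H : mgraph.
Hypothesis HP : pole H.
Implicit Types (X U W : {set H}).
Local Notation T := (terminals H).

Definition has_good_pairing : Prop :=
  exists a1 a2 a3 a4 a5 : H,
    [/\ uniq [:: a1; a2; a3; a4; a5], T =i [:: a1; a2; a3; a4; a5],
        good_pair a1 a2 & good_pair a4 a5].

Lemma enum_terminals (s : seq H) : uniq s -> {subset s <= T} ->
  exists2 r, size r = 5 - size s & uniq (s ++ r) /\ T =i s ++ r.
Proof.
move=> us sT; exists (enum (T :\: [set x in s])).
  rewrite -cardE cardsD (card_terminals HP) (setIidPr _) ?cardsE ?(card_uniqP us) //.
  by apply/subsetP=> x; rewrite inE; apply: sT.
split.
  rewrite cat_uniq us enum_uniq andbT; apply/hasPn=> x.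
  by rewrite mem_enum !inE => /andP[].
move=> x; rewrite mem_cat mem_enum !inE; case: (boolP (x \in s)) => //= /sT.
by rewrite inE.
Qed.

Lemma pairingI p q s t : uniq [:: p; q; s; t] -> {subset [:: p; q; s; t] <= T} ->
  good_pair p q -> good_pair s t -> has_good_pairing.
Proof.
move=> u sub g1 g2; have [[|r [|? ?]] //= _ [u' ET]] := enum_terminals u sub.
have P : perm_eq [:: p; q; r; s; t] [:: p; q; s; t; r].
  by rewrite !perm_cons -[X in perm_eq X]/([:: r] ++ [:: s; t]) perm_catC.
exists p, q, r, s, t; split=> //; first by rewrite (perm_uniq P).
by move=> x; rewrite (perm_mem P) ET.
Qed.

(** Any cycle of H has at least 5 vertices, hence uses all of them and all 5 edges. *)
Lemma cycle5_of_card : #|H| <= 5 -> is_cycle_graph H 5.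
Proof.
move=> H5; have [c cyc _] := cyclic_set_cycle (pole_cyclic HP).
have [cardC HC] := is_cycle_card cyc; have [c0 cy uV uE] := cyc.
set C := [set v in _] in cardC HC.
have ge5 : 5 <= #|C|.
  rewrite ltnNge; apply/negP=> le4; have := @sparse_small _ HP C.
  by case/andP: HC => -> ; rewrite le4 => leC /(_ isT); lia.
have CH : #|C| <= #|H| by apply: max_card.
have EH : #|edge H| = 5 by have := pole_card HP; lia.
exists c; split=> //; first by lia.
- move=> v; have /eqP CT : C == setT by rewrite eqEcard subsetT cardsT; lia.
  by move/setP/(_ v): CT; rewrite !inE.
- have /eqP ET : [set e in map fst c] == setT.
    by rewrite eqEcard subsetT cardsT cardsE (card_uniqP uE) size_map EH -[X in _ <= X]cardC.
  by move=> e; move/setP/(_ e): ET; rewrite !inE.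
Qed.

(** Terminals t, s, u forming a path have at most 2 edges leaving U = {t, s, u}.
    The complement contains the other two terminals, so small_boundary gives it
    two vertices, and H has five. *)
Lemma terminal_nbr_unique s t u : ~ is_cycle_graph H 5 ->
  s \in T -> t \in T -> u \in T -> adj s t -> adj s u -> t = u.
Proof.
move=> nC sT tT uT st su; apply/eqP; apply: contraT => tu; case: nC.
apply: cycle5_of_card.
have [nst nsu] := (adj_neq HP st, adj_neq HP su).
pose U := s |: [set t; u].
have sU : s \notin [set t; u] by rewrite !inE negb_or nst.
have U3 : #|U| = 3 by rewrite cardsU1 sU cards2 tu.
have UT : U :&: T = U.
  by apply/setIidPl/subsetP=> x; rewrite in_setU1 in_set2 => /or3P[]/eqP ->.
have in2 := inner_add2 sU (set21 t u) (set22 t u) tu st su.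
have := pole_count HP U; rewrite UT U3 -/U => cnt.
have card_compl : #|~: U :&: T| = 2.
  by have := card_compl_terminals HP U; rewrite UT U3; lia.
have := @small_boundary _ HP (~: U); rewrite boundaryC card_compl.
have := cardsC U; rewrite -/U in in2; lia.
Qed.

(** A terminal adjacent to a terminal has only one other neighbour. *)
Lemma one_mid a b m m' : a \in T -> b \in T -> m \notin T -> m' \notin T ->
  adj a b -> adj a m -> adj a m' -> m = m'.
Proof.
move=> aT bT mT m'T ab am am'; have := terminal_nbrs aT ab am am'.
have /negbTE -> : b != m by apply: contraNneq mT => <-.
have /negbTE -> : b != m' by apply: contraNneq m'T => <-.
by move=> /= /eqP.
Qed.

(** The only possible neighbour of a inside U is the one other than b, so removing a
    from U does not increase the boundary, while one terminal remains: U minus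
    a has at most two vertices. *)
Lemma pinched_linked a b c : ~ is_cycle_graph H 5 ->
  a \in T -> b \in T -> c \in T -> adj a b -> c != a -> c != b ->
  pinched a c -> linked a c.
Proof.
move=> nC aT bT cT ab ca cb /existsP[U /andP[/eqP UT le3]].
have nac : ~~ adj a c.
  apply/negP=> ac; case/eqP: cb; symmetry.
  exact: (terminal_nbr_unique nC aT bT cT ab ac).
have /setIP[aU _] : a \in U :&: T by rewrite UT !inE eqxx.
have bU : b \notin U.
  apply/negP=> bU; have : b \in U :&: T by rewrite inE bU.
  by rewrite UT !inE eq_sym (negbTE (adj_neq HP ab)) eq_sym (negbTE cb).
have ac : a != c by rewrite eq_sym.
apply: (linked_of_small HP _ _ UT le3) => //.
have le1 : #|[set e in inner U | (src e == a) || (tgt e == a)]| <= 1.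
  have := card_edges_at a; move: (aT); rewrite inE => /eqP ->.
  have /existsP[e He] := ab.
  rewrite (cardsD1 e) inE.
  have -> : (src e == a) || (tgt e == a).
    by case/orP: He => /andP[E1 E2]; rewrite ?E1 ?E2 ?orbT.
  rewrite add1n ltnS; apply: leq_trans; apply: subset_leq_card; apply/subsetP=> f.
  rewrite !inE => /andP[/andP[sU tU] ->]; rewrite andbT.
  apply: contraNneq bU => Ef; rewrite Ef in sU tU.
  by case/orP: He => /andP[/eqP E1 /eqP E2]; rewrite -?E2 // -E1.
have := inner_D1 U a; have := cardsD1 a U; rewrite aU => E1 E2.
have UT' : (U :\ a) :&: T = [set c].
  rewrite setIDAC UT; apply/setP=> x; rewrite !inE.
  by case: eqP => //= ->; rewrite (negbTE ac).
have := pole_count HP U; have := pole_count HP (U :\ a).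
rewrite UT' UT cards1 cards2 ac => c1 c2.
have := @small_boundary _ HP (U :\ a); rewrite UT' cards1; lia.
Qed.

Lemma linked_common_mid x y z w : x \in T -> w \in T -> adj x w ->
  linked x y -> linked x z -> exists m, [/\ m \notin T, adj x m, adj y m & adj z m].
Proof.
move=> xT wT xw /linkedP[m [mT xm ym]] /linkedP[m' [m'T xm' zm']].
by exists m; split=> //; rewrite (one_mid xT wT mT m'T xw xm xm').
Qed.

(** The common neighbours would coincide by one_mid, giving a triangle. *)
Lemma linked_edge_absurd x y z w : x \in T -> w \in T -> adj x w -> adj y z ->
  linked x y -> linked x z -> False.
Proof.
move=> xT wT xw yz lxy lxz.
have [m [_ _ ym zm]] := linked_common_mid xT wT xw lxy lxz.
exact: (no_triangle HP yz zm ym).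
Qed.

Lemma good_across_edges a b d e : ~ is_cycle_graph H 5 ->
  uniq [:: a; b; d; e] -> {subset [:: a; b; d; e] <= T} -> adj a b -> adj d e ->
  ~~ linked a d -> good_pair a d.
Proof.
move=> nC u sub ab de nl.
have [aT bT dT eT] : [/\ a \in T, b \in T, d \in T & e \in T].
  by split; apply: sub; rewrite !inE eqxx ?orbT.
have [[|c [|? ?]] //= _ [_ ET]] := enum_terminals u sub.
move: u; rewrite /= !inE !negb_or => /and4P[/and3P[nab nad nae] /andP[nbd nbe] nde _].
have ba : adj b a by rewrite adjC.
have ed : adj e d by rewrite adjC.
split.
  by apply: contra nl; apply: (pinched_linked nC aT bT dT ab); rewrite eq_sym.
have key s t : s \in T -> t \in T -> adj s t -> s \in [:: a; b; d; e] ->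
    (s \in [:: a; d]) || (t \in [:: a; d]).
  move=> sT tT st; rewrite !inE => /or4P[]/eqP Es; subst s; rewrite ?eqxx ?orbT //.
    by rewrite -(terminal_nbr_unique nC bT aT tT ba st) eqxx !orbT.
  by rewrite -(terminal_nbr_unique nC eT dT tT ed st) eqxx !orbT.
move=> s t sT tT st; have ts : adj t s by rewrite adjC.
have := sT; have := tT; rewrite !ET -[[:: a, _, _, _ & _]]/([:: a; b; d; e] ++ [:: c]).
rewrite !mem_cat => /orP[/(key _ _ tT sT ts)|tc]; first by rewrite orbC.
case/orP=> [/(key _ _ sT tT st) //|sc].
by move: tc sc st; rewrite !inE => /eqP -> /eqP ->; rewrite (adj_irr HP).
Qed.

(** The pairs must be {a, d}, {b, e} or {a, e}, {b, d}.  One of the choices works: by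
    linked_edge_absurd, no terminal of one edge is linked to both ends of the
    other edge. *)
Lemma pairing_of_two_terminal_edges a b d e : ~ is_cycle_graph H 5 ->
  uniq [:: a; b; d; e] -> {subset [:: a; b; d; e] <= T} -> adj a b -> adj d e ->
  has_good_pairing.
Proof.
move=> nC u sub ab de.
have [aT bT dT eT] : [/\ a \in T, b \in T, d \in T & e \in T].
  by split; apply: sub; rewrite !inE eqxx ?orbT.
have ba : adj b a by rewrite adjC.
have ed : adj e d by rewrite adjC.
move: (u); rewrite /= !inE !negb_or => /and4P[/and3P[nab nad nae] /andP[nbd nbe] nde _].
have u1 : uniq [:: b; a; d; e].
  by rewrite /= !inE !negb_or [b == a]eq_sym nab nad nae nbd nbe nde.
have u2 : uniq [:: a; b; e; d].
  by rewrite /= !inE !negb_or nab nad nae nbd nbe eq_sym nde.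
have u3 : uniq [:: b; a; e; d].
  by rewrite /= !inE !negb_or [b == a]eq_sym nab nad nae nbd nbe eq_sym nde.
have s1 : {subset [:: b; a; d; e] <= T} by apply/allP; rewrite /= aT bT dT eT.
have s2 : {subset [:: a; b; e; d] <= T} by apply/allP; rewrite /= aT bT dT eT.
have s3 : {subset [:: b; a; e; d] <= T} by apply/allP; rewrite /= aT bT dT eT.
have g_ad := good_across_edges nC u sub ab de.
have g_bd := good_across_edges nC u1 s1 ba de.
have g_ae := good_across_edges nC u2 s2 ab ed.
have g_be := good_across_edges nC u3 s3 ba ed.
have nd_ne := linked_edge_absurd aT bT ab de.
have nd_ne' := linked_edge_absurd bT aT ba de.
have na_nb := linked_edge_absurd dT eT de ab; rewrite ![linked d _]linkedC in na_nb.
have na_nb' := linked_edge_absurd eT dT ed ab; rewrite ![linked e _]linkedC in na_nb'.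
case Ead: (linked a d) g_ad nd_ne na_nb => g_ad nd_ne na_nb.
  have nae' : ~~ linked a e by apply/negP=> /(nd_ne isT).
  have nbd' : ~~ linked b d by apply/negP=> /(na_nb isT).
  apply: (@pairingI a e b d) (g_ae nae') (g_bd nbd').
    by rewrite /= !inE !negb_or nae nab nad [e == b]eq_sym nbe [e == d]eq_sym nde nbd.
  by apply/allP; rewrite /= aT bT dT eT.
case Ebe: (linked b e) g_be nd_ne' na_nb' => g_be nd_ne' na_nb'.
  have nae' : ~~ linked a e by apply/negP=> /na_nb'/(_ isT).
  have nbd' : ~~ linked b d by apply/negP=> /nd_ne'/(_ isT).
  apply: (@pairingI a e b d) (g_ae nae') (g_bd nbd').
    by rewrite /= !inE !negb_or nae nab nad [e == b]eq_sym nbe [e == d]eq_sym nde nbd.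
  by apply/allP; rewrite /= aT bT dT eT.
apply: (@pairingI a d b e) (g_ad isT) (g_be isT).
  by rewrite /= !inE !negb_or nad nab nae [d == b]eq_sym nbd nde nbe.
by apply/allP; rewrite /= aT bT dT eT.
Qed.

Lemma good_of_single_edge x w y : ~ is_cycle_graph H 5 ->
  x \in T -> w \in T -> adj x w ->
  (forall s t, s \in T -> t \in T -> adj s t -> (s \in [:: x; w]) || (t \in [:: x; w])) ->
  y \in T -> y != x -> y != w -> ~~ linked x y -> good_pair x y.
Proof.
move=> nC xT wT xw meets yT yx yw nl; split.
  by apply: contra nl; apply: (pinched_linked nC xT wT yT xw).
have wx : adj w x by rewrite adjC.
move=> s t sT tT st; have ts : adj t s by rewrite adjC.
case/orP: (meets s t sT tT st); rewrite !inE => /orP[]/eqP E; subst.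
- by rewrite eqxx.
- by rewrite -(terminal_nbr_unique nC wT xT tT wx st) eqxx !orbT.
- by rewrite eqxx !orbT.
- by rewrite -(terminal_nbr_unique nC wT xT sT wx ts) eqxx.
Qed.

(** Partners for a and b are sought among the other terminals c, d, e.  The only other
    neighbour of a has degree at most 3, so a is not linked to all of c, d, e,
    and likewise b; and if a and b were both linked to the same two
    terminals, a 4-cycle would arise.  Hence a and b have distinct partners. *)
Lemma pairing_of_single_terminal_edge a b : ~ is_cycle_graph H 5 ->
  a \in T -> b \in T -> adj a b ->
  (forall s t, s \in T -> t \in T -> adj s t -> (s \in [:: a; b]) || (t \in [:: a; b])) ->
  has_good_pairing.
Proof.
move=> nC aT bT ab meets.
have nab : a != b := adj_neq HP ab.
have ba : adj b a by rewrite adjC.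
have u2 : uniq [:: a; b] by rewrite /= inE nab.
have sub2 : {subset [:: a; b] <= T} by apply/allP; rewrite /= aT bT.
have [[|c [|d [|e [|? ?]]]] //= _ [u5 ET]] := enum_terminals u2 sub2.
have meets' s t : s \in T -> t \in T -> adj s t -> (s \in [:: b; a]) || (t \in [:: b; a]).
  by move=> sT tT /(meets s t sT tT); rewrite !inE [(s == b) || _]orbC [(t == b) || _]orbC.
have three x w : x \in T -> w \in T -> adj x w -> uniq [:: x; c; d; e] ->
    linked x c -> linked x d -> linked x e -> False.
  move=> xT wT xw u l1 l2 l3; move: (u); rewrite /= !inE !negb_or.
  case/and4P=> /and3P[xc xd xe] /andP[cd ce] de _.
  have [m [mT xm cm dm]] : exists m, [/\ m \notin T, adj x m, adj c m & adj d m].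
    exact: (linked_common_mid xT wT xw).
  have [m' [m'T xm' _ em']] : exists m, [/\ m \notin T, adj x m, adj c m & adj e m].
    exact: (linked_common_mid xT wT xw).
  have E := one_mid xT wT mT m'T xw xm xm'; subst m'.
  by apply: (four_nbrs HP (v := m) u); rewrite adjC.
have two y z : uniq [:: a; b; y; z] -> linked a y -> linked a z -> linked b y -> linked b z -> False.
  rewrite /= !inE !negb_or => /and4P[/and3P[_ ay az] /andP[bY bz] yz _] l1 l2 l3 l4.
  have [m [mT am ym zm]] : exists m, [/\ m \notin T, adj a m, adj y m & adj z m].
    exact: (linked_common_mid aT bT ab).
  have [n [nT bn yn zn]] : exists m, [/\ m \notin T, adj b m, adj y m & adj z m].
    exact: (linked_common_mid bT aT ba).
  apply: (no_4cycle HP ym yn zm zn yz); apply: contraTneq (ab) => E; subst n.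
  by apply/negP=> _; apply: (no_triangle HP ab bn am).
have finish y z : uniq [:: a; b; y; z] -> y \in T -> z \in T -> ~~ linked a y -> ~~ linked b z ->
    has_good_pairing.
  move=> u yT zT l1 l2; move: u; rewrite /= !inE !negb_or.
  case/and4P=> /and3P[_ ay az] /andP[bY bz] yz _.
  apply: (@pairingI a y b z).
  - by rewrite /= !inE !negb_or ay nab az yz [y == b]eq_sym bY bz.
  - by apply/allP; rewrite /= aT bT yT zT.
  - by apply: (good_of_single_edge nC aT bT ab meets) => //; rewrite eq_sym.
  - by apply: (good_of_single_edge nC bT aT ba meets') => //; rewrite eq_sym.
have [cT dT eT] : [/\ c \in T, d \in T & e \in T].
  by split; rewrite ET !inE eqxx ?orbT.
move: u5; rewrite /= !inE !negb_or.
case/and5P=> /and4P[_ ac ad ae] /and3P[bc bd be] /andP[cd ce] de _.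
have t1 := three a b aT bT ab; have t2 := three b a bT aT ba.
have w1 := two c d; have w2 := two c e; have w3 := two d e.
have f1 u := finish c d u cT dT.
have f2 u := finish d c u dT cT.
have f3 u := finish c e u cT eT.
have f4 u := finish e c u eT cT.
have f5 u := finish d e u dT eT.
have f6 u := finish e d u eT dT.
move: t1 t2 w1 w2 w3 f1 f2 f3 f4 f5 f6.
rewrite /= !inE !negb_or nab [d == c]eq_sym [e == c]eq_sym [e == d]eq_sym.
rewrite ac ad ae bc bd be cd ce de.
case: (linked a c); case: (linked a d); case: (linked a e);
case: (linked b c); case: (linked b d); case: (linked b e) => t1 t2 w1 w2 w3 f1 f2 f3 f4 f5 f6;
by [case: (t1 isT isT isT isT) | case: (t2 isT isT isT isT) | case: (w1 isT isT isT isT isT)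
  | case: (w2 isT isT isT isT isT) | case: (w3 isT isT isT isT isT)
  | apply: f1 | apply: f2 | apply: f3 | apply: f4 | apply: f5 | apply: f6].
Qed.

Lemma pairing_of_adjacent a b : ~ is_cycle_graph H 5 ->
  a \in T -> b \in T -> adj a b -> has_good_pairing.
Proof.
move=> nC aT bT ab.
have [/existsP[d /existsP[e /and5P[dT eT da ea de]]]|none] := boolP
    [exists d, exists e, [&& d \in T, e \in T, d \notin [:: a; b], e \notin [:: a; b] & adj d e]].
  apply: (@pairing_of_two_terminal_edges a b d e) => //; last first.
    by apply/allP; rewrite /= aT bT dT eT.
  rewrite -[[:: a, _, _ & _]]/([:: a; b] ++ [:: d; e]) cat_uniq /= !inE (adj_neq HP ab).
  by rewrite (adj_neq HP de) !orbF !andbT; move: da ea; rewrite !inE => /negbTE -> /negbTE ->.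
apply: (pairing_of_single_terminal_edge nC aT bT ab) => s t sT tT st.
apply: contraNT none; rewrite negb_or => /andP[nsab ntab].
by apply/existsP; exists s; apply/existsP; exists t; rewrite sT tT nsab ntab.
Qed.

End Pairing.

(** * Good pairs when no two terminals are adjacent *)

Section NoAdjacentTerminals.
Variable H : mgraph.
Hypothesis HP : pole H.
Implicit Types (X U W : {set H}).
Local Notation T := (terminals H).
Hypothesis indep : forall s t, s \in T -> t \in T -> ~~ adj s t.

(** Otherwise X would consist of its two terminals, and counting would make them
    adjacent. *)
Lemma boundary_two_terminals X : #|X :&: T| = 2 -> 3 <= #|boundary X|.
Proof.
move=> X2; rewrite leqNgt; apply/negP=> lt3.
have le2 : #|X| <= 2 by apply: (small_boundary HP); rewrite X2; lia.
have XT : X :&: T = X by apply/eqP; rewrite eqEcard subsetIl X2.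
rewrite XT in X2; have /cards2P[s [t [st EX]]] : #|X| == 2 by rewrite X2.
have [sT tT] : s \in T /\ t \in T.
  by split; apply: (subsetP (introT setIidPl XT)); rewrite EX !inE eqxx ?orbT.
have := indep sT tT; rewrite (inner2 HP st) // -EX.
by have := pole_count HP X; rewrite XT X2; lia.
Qed.

(** The complement of the union contains two terminals, so at least 3 edges leave the
    union; by submodularity at most 3 leave the intersection, which
    therefore has at most two vertices.  By posimodularity one of the two
    differences is left by at most 3 edges, so has at most two vertices as
    well.  That gives one of the sets at most four vertices, and parity
    excludes four. *)
Lemma pinched_adjacent_pairs p q r U1 U2 :
  uniq [:: p; q; r] -> U1 :&: T = [set p; q] -> U2 :&: T = [set p; r] ->
  #|boundary U1| <= 3 -> #|boundary U2| <= 3 -> #|U1| <= 3 \/ #|U2| <= 3.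
Proof.
rewrite /= !inE !negb_or => /and3P[/andP[pq pr] qr _] UT1 UT2 le1 le2.
have TI : (U1 :&: U2) :&: T = [set p].
  rewrite -(setIid T) setIACA UT1 UT2; apply/setP=> x; rewrite !inE.
  case: eqP => //= _; case: (x =P q) => //= ->; exact: negbTE.
have TU : (U1 :|: U2) :&: T = p |: [set q; r].
  by rewrite setIUl UT1 UT2; apply/setP=> x; rewrite !inE; case: eqP; case: eqP; case: eqP.
have T1 : (U1 :\: U2) :&: T = [set q].
  apply/setP=> x; move/setP/(_ x): UT1; move/setP/(_ x): UT2; rewrite !inE.
  case: (x \in U1); case: (x \in U2); case: (deg x == 2) => //=;
  case: (x =P p) => [->|]; rewrite ?(negbTE pq) ?(negbTE pr) //=;
  case: (x =P q) => [->|]; rewrite ?(negbTE qr) //.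
have T2 : (U2 :\: U1) :&: T = [set r].
  apply/setP=> x; move/setP/(_ x): UT1; move/setP/(_ x): UT2; rewrite !inE.
  case: (x \in U1); case: (x \in U2); case: (deg x == 2) => //=;
  case: (x =P p) => [->|]; rewrite ?(negbTE pq) ?(negbTE pr) //=;
  case: (x =P r) => [->|]; rewrite ?[r == q]eq_sym ?(negbTE qr) //.
have c3 : #|(U1 :|: U2) :&: T| = 3 by rewrite TU cardsU1 cards2 qr !inE negb_or pq pr.
have cup3 : 3 <= #|boundary (U1 :|: U2)|.
  rewrite -boundaryC; apply: boundary_two_terminals; by rewrite (card_compl_terminals HP) c3.
have sub := boundary_submodular U1 U2; have pos := boundary_posimodular U1 U2.
have cap : #|U1 :&: U2| <= 2 by apply: (small_boundary HP); rewrite TI cards1; lia.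
have n1 := pole_count HP U1; have n2 := pole_count HP U2.
rewrite UT1 cards2 pq in n1; rewrite UT2 cards2 pr in n2.
have s1 := @small_boundary _ HP U1; rewrite UT1 cards2 pq in s1.
have s2 := @small_boundary _ HP U2; rewrite UT2 cards2 pr in s2.
have k1 := cardsID U2 U1; have k2 := cardsID U1 U2; rewrite [U2 :&: U1]setIC in k2.
have [d1|d1] := leqP #|boundary (U1 :\: U2)| 3.
  left; have : #|U1 :\: U2| <= 2 by apply: (small_boundary HP); rewrite T1 cards1; lia.
  by clear -s1 n1 k1 cap le1; lia.
right; have : #|U2 :\: U1| <= 2 by apply: (small_boundary HP); rewrite T2 cards1; lia.
by clear -s2 n2 k2 cap le2; lia.
Qed.

Lemma pinchedP p q : reflect (exists2 U, U :&: T = [set p; q] & #|boundary U| <= 3) (pinched p q).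
Proof.
by apply: (iffP existsP) => -[U] => [/andP[/eqP ? ?]|/eqP E ?]; exists U => //; apply/andP.
Qed.

(** Otherwise V = {p, m, r} meets U in p only.  At least 3 edges leave V minus U =
    {m, r}, so by posimodularity at most 3 leave U minus V, which contains only
    the terminal q and so has at most two vertices; then U has at most three. *)
Lemma mid_in_pinching U p q r m :
  uniq [:: p; q; r] -> p \in T -> r \in T -> m \notin T ->
  U :&: T = [set p; q] -> #|boundary U| <= 3 -> 3 < #|U| ->
  adj p m -> adj r m -> m \in U.
Proof.
move=> u pT rT mT UT le3 big pm rm; apply: contraLR big => mU; rewrite -leqNgt.
move: u; rewrite /= !inE !negb_or => /and3P[/andP[pq pr] qr _].
have /setIP[pU _] : p \in U :&: T by rewrite UT !inE eqxx.
have /setIP[qU qT] : q \in U :&: T by rewrite UT !inE eqxx orbT.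
have rU : r \notin U.
  apply/negP=> rU; have : r \in U :&: T by rewrite inE rU.
  by rewrite UT !inE eq_sym (negbTE pr) eq_sym (negbTE qr).
have [npm nrm] := (adj_neq HP pm, adj_neq HP rm).
have mp : m != p by rewrite eq_sym.
have mr : m != r by rewrite eq_sym.
pose V := m |: [set p; r].
have mV : m \notin [set p; r] by rewrite !inE negb_or mp mr.
have cV : #|V| = 3 by rewrite cardsU1 mV cards2 pr.
have VT : V :&: T = [set p; r].
  apply/setP=> x; rewrite [in RHS]in_set2 in_setI in_setU1 in_set2.
  case: (x =P p) => [->|_]; first by rewrite pT orbT.
  case: (x =P r) => [->|_]; first by rewrite rT !orbT.
  by rewrite orbF; case: (x =P m) => [->|//]; rewrite (negbTE mT).
have leV : #|boundary V| <= 3.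
  have mp' : adj m p by rewrite adjC.
  have mr' : adj m r by rewrite adjC.
  have c2 : #|[set p; r]| = 2 by rewrite cards2 pr.
  have := inner_add2 mV (set21 p r) (set22 p r) pr mp' mr'; rewrite -/V => in2.
  have := pole_count HP V; rewrite VT c2 cV.
  by clear -in2; lia.
have DV : V :\: U = [set m; r].
  apply/setP=> x; rewrite !inE; case: (x =P m) => [->|_]; first by rewrite mU.
  case: (x =P r) => [->|_]; first by rewrite rU orbT.
  by rewrite orbF; case: (x =P p) => [->|_]; rewrite ?pU ?andbF.
have DVT : [set m; r] :&: T = [set r].
  apply/setP=> x; rewrite [in RHS]in_set1 in_setI in_set2.
  case: (x =P r) => [->|_]; first by rewrite rT orbT.
  by rewrite orbF; case: (x =P m) => [->|//]; rewrite (negbTE mT).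
have DU : (U :\: V) :&: T = [set q].
  have qV : q \notin V.
    rewrite in_setU1 in_set2 !negb_or [q == p]eq_sym pq qr !andbT.
    by apply: contraNneq mU => <-.
  rewrite setIDAC UT; apply/setP=> x; rewrite in_setD in_set2 in_set1.
  case: (x =P q) => [->|_]; first by rewrite qV orbT.
  rewrite orbF; case: (x =P p) => [->|_]; last by rewrite andbF.
  by rewrite in_setU1 set21 orbT.
have ge3 : 3 <= #|boundary (V :\: U)|.
  have c2 : #|[set m; r]| = 2 by rewrite cards2 mr.
  have := pole_count HP (V :\: U); have := @sparse_small _ HP [set m; r].
  rewrite DV DVT c2 (cards1 r) => /(_ isT); clear; lia.
have := boundary_posimodular U V => pos.
have le2 : #|U :\: V| <= 2 by apply: (small_boundary HP); rewrite DU (cards1 q); clear -pos ge3 le3 leV; lia.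
have UV : #|U :&: V| <= 1.
  rewrite -(cards1 p); apply: subset_leq_card; apply/subsetP=> x.
  rewrite !inE => /andP[xU /or3P[]] // /eqP Ex; subst x; first by rewrite xU in mU.
  by rewrite xU in rU.
by move: (cardsID V U) UV le2; clear; lia.
Qed.

(** If p and q are not linked, the set U pinching them is large, so r is linked to both
    p and q, and by mid_in_pinching both neighbours of r lie in U.  Adding
    r to U then removes two edges from its boundary, which leaves only one edge
    around a set with three terminals. *)
Lemma pinched_triangle p q r : uniq [:: p; q; r] -> p \in T -> q \in T -> r \in T ->
  pinched p q -> pinched p r -> pinched q r -> linked p q.
Proof.
move=> u pT qT rT /pinchedP[U UT leU] /pinchedP[U2 UT2 leU2] /pinchedP[U3 UT3 leU3].
move: (u); rewrite /= !inE !negb_or => /and3P[/andP[pq pr] qr _].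
have u' : uniq [:: q; p; r] by rewrite /= !inE negb_or [q == p]eq_sym pq qr pr.
have UT' : U :&: T = [set q; p] by rewrite setUC.
apply: contraT => npq.
have big : 3 < #|U|.
  rewrite ltnNge; apply: contra npq => le3.
  exact: (linked_of_small HP pq (indep pT qT) UT).
have [m1 [m1T pm1 rm1]] : exists m, [/\ m \notin T, adj p m & adj r m].
  case: (pinched_adjacent_pairs u UT UT2 leU leU2) => [|le3]; first by rewrite leqNgt big.
  by apply/linkedP; apply: (linked_of_small HP pr (indep pT rT) UT2).
have [m2 [m2T qm2 rm2]] : exists m, [/\ m \notin T, adj q m & adj r m].
  case: (pinched_adjacent_pairs u' UT' UT3 leU leU3) => [|le3]; first by rewrite leqNgt big.
  by apply/linkedP; apply: (linked_of_small HP qr (indep qT rT) UT3).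
have m1U := mid_in_pinching u pT rT m1T UT leU big pm1 rm1.
have m2U := mid_in_pinching u' qT rT m2T UT' leU big qm2 rm2.
have m12 : m1 != m2.
  apply: contraNneq npq => E; subst m2; by apply/linkedP; exists m1.
have rU : r \notin U.
  apply/negP=> rU; have : r \in U :&: T by rewrite inE rU.
  by rewrite UT !inE eq_sym (negbTE pr) eq_sym (negbTE qr).
have RT : (r |: U) :&: T = r |: [set p; q].
  rewrite setIUl UT; congr (_ :|: _); apply/setIidPl/subsetP=> x.
  by rewrite in_set1 => /eqP ->.
have cRT : #|(r |: U) :&: T| = 3.
  by rewrite RT cardsU1 cards2 pq !inE negb_or [r == p]eq_sym pr [r == q]eq_sym qr.
have := inner_add2 rU m1U m2U m12 rm1 rm2.
have := pole_count HP U; rewrite UT cards2 pq => n1.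
have := pole_count HP (r |: U); rewrite cRT => n2.
have := @small_boundary _ HP (r |: U); rewrite cRT.
have cU : #|r |: U| = #|U|.+1 by rewrite cardsU1 rU.
move: n2; rewrite cU; clear -n1 big leU; lia.
Qed.

(** The links of s to p, q, r use its only two neighbours, so one of them serves two
    of p, q, r.  That neighbour is not m, whose neighbours are p, q, r, so a
    4-cycle arises. *)
Lemma linked_star m p q r s : uniq [:: p; q; r; s] -> s \in T ->
  adj p m -> adj q m -> adj r m -> linked s p -> linked s q -> linked s r -> False.
Proof.
move=> u sT pm qm rm /linkedP[n1 [_ sn1 pn1]] /linkedP[n2 [_ sn2 qn2]] /linkedP[n3 [_ sn3 rn3]].
move: (u); rewrite /= !inE !negb_or => /and4P[/and3P[pq pr ps] /andP[qr qs] rs _].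
have nsm : ~~ adj m s.
  by apply/negP=> ms; apply: (four_nbrs HP (v := m) u); rewrite // adjC.
have key x y n : x != y -> adj x m -> adj y m -> adj s n -> adj x n -> adj y n -> False.
  move=> xy xm ym sn xn yn; apply: (no_4cycle HP xm xn ym yn xy).
  by apply: contraNneq nsm => ->; rewrite adjC.
by case/or3P: (terminal_nbrs sT sn1 sn2 sn3) => /eqP E; subst;
  [apply: (key p q n2)|apply: (key p r n3)|apply: (key q r n3)].
Qed.

(** Since p has two neighbours, one of them serves two of its three links. *)
Lemma linked_K4 p q r s : uniq [:: p; q; r; s] -> {subset [:: p; q; r; s] <= T} ->
  linked p q -> linked p r -> linked p s -> linked q r -> linked q s -> linked r s -> False.
Proof.
move=> u sub lpq lpr lps lqr lqs lrs.
have [pT qT rT sT] : [/\ p \in T, q \in T, r \in T & s \in T].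
  by split; apply: sub; rewrite !inE eqxx ?orbT.
move: (u); rewrite /= !inE !negb_or => /and4P[/and3P[pq pr ps] /andP[qr qs] rs _].
have /linkedP[m1 [_ pm1 qm1]] := lpq; have /linkedP[m2 [_ pm2 rm2]] := lpr.
have /linkedP[m3 [_ pm3 sm3]] := lps.
have [lqp lrp lsp] : [/\ linked q p, linked r p & linked s p] by split; rewrite linkedC.
have [lrq lsq lsr] : [/\ linked r q, linked s q & linked s r] by split; rewrite linkedC.
case/or3P: (terminal_nbrs pT pm1 pm2 pm3) => /eqP E; subst.
- exact: (@linked_star m2 p q r s).
- apply: (@linked_star m3 p q s r) => //.
  by rewrite /= !inE !negb_or pq ps pr qs qr eq_sym rs.
- apply: (@linked_star m3 p r s q) => //.
  by rewrite /= !inE !negb_or pr ps pq rs [r == q]eq_sym qr [s == q]eq_sym qs.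
Qed.

(** The vertex m has the neighbours p, r, s and no others, so the other neighbour m' of
    p serves q and t.  Then q cannot be linked to r or s through m', nor
    through m, and a single further neighbour of q serving both r and s closes
    a 4-cycle with m. *)
Lemma linked_hub m p q r s t : uniq [:: p; q; r; s; t] -> p \in T -> q \in T ->
  adj p m -> adj r m -> adj s m ->
  linked p q -> linked p t -> linked q r -> linked q s -> False.
Proof.
move=> u pT qT pm rm sm /linkedP[m' [_ pm' qm']] /linkedP[m2 [_ pm2 tm2]].
move=> /linkedP[n1 [_ qn1 rn1]] /linkedP[n2 [_ qn2 sn2]].
move: (u); rewrite /= !inE !negb_or.
case/and5P=> /and4P[pq pr ps pt] /and3P[qr qs qt] /andP[rs rt] st _.
have nq : ~~ adj q m.
  apply/negP=> qm; apply: (@four_nbrs _ HP m p q r s); rewrite 1?adjC //.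
  by rewrite /= !inE !negb_or pq pr ps qr qs rs.
have nt : ~~ adj t m.
  apply/negP=> tm; apply: (@four_nbrs _ HP m p r s t); rewrite 1?adjC //.
  by rewrite /= !inE !negb_or pr ps pt rs rt st.
have Em : m2 = m'.
  case/or3P: (terminal_nbrs pT pm pm' pm2) => /eqP E; subst => //.
    by rewrite qm' in nq.
  by rewrite tm2 in nt.
subst m2.
have last z : z \in [:: r; s] -> adj q m' -> adj z m' -> False.
  move=> zrs _ zm'; apply: (@four_nbrs _ HP m' p q t z); rewrite 1?adjC //.
  move: zrs; rewrite /= !inE !negb_or pq pt qt => /orP[]/eqP -> /=.
    by rewrite pr qr eq_sym rt.
  by rewrite ps qs eq_sym st.
case/or3P: (terminal_nbrs qT qm' qn1 qn2) => /eqP E; subst.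
- by apply: (last r) => //; rewrite inE eqxx.
- by apply: (last s) => //; rewrite !inE eqxx orbT.
- apply: (no_4cycle HP rm rn1 sm sn2 rs).
  by apply: contraNneq nq => ->.
Qed.

Lemma linked_K5_minus_triangle p q r s t :
  uniq [:: p; q; r; s; t] -> p \in T -> q \in T ->
  linked p q -> linked p r -> linked p s -> linked p t ->
  linked q r -> linked q s -> linked q t -> False.
Proof.
move=> u pT qT lpq lpr lps lpt lqr lqs lqt.
have /linkedP[m1 [_ pm1 rm1]] := lpr; have /linkedP[m2 [_ pm2 sm2]] := lps.
have /linkedP[m3 [_ pm3 tm3]] := lpt.
case/or3P: (terminal_nbrs pT pm1 pm2 pm3) => /eqP E; subst.
- exact: (@linked_hub m2 p q r s t).
- apply: (@linked_hub m3 p q r t s) => //; move: u.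
  by rewrite /= !inE ![_ == t]eq_sym; do ![case: (_ == _) => //=].
- apply: (@linked_hub m3 p q s t r) => //; move: u.
  by rewrite /= !inE ![_ == r]eq_sym; do ![case: (_ == _) => //=].
Qed.

Lemma pinched_K4 p q r s : uniq [:: p; q; r; s] -> {subset [:: p; q; r; s] <= T} ->
  pinched p q -> pinched p r -> pinched p s -> pinched q r -> pinched q s -> pinched r s -> False.
Proof.
move=> u sub pq pr ps qr qs rs.
have [pT qT rT sT] : [/\ p \in T, q \in T, r \in T & s \in T].
  by split; apply: sub; rewrite !inE eqxx ?orbT.
move: (u); rewrite /= !inE !negb_or => /and4P[/and3P[npq npr nps] /andP[nqr nqs] nrs _].
have tri x y z : x != y -> x != z -> y != z -> x \in T -> y \in T -> z \in T ->
    pinched x y -> pinched x z -> pinched y z -> linked x y.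
  by move=> xy xz yz; apply: pinched_triangle; rewrite /= !inE negb_or xy xz yz.
apply: (linked_K4 u sub).
- by apply: (tri p q r).
- by apply: (tri p r q); rewrite // 1?eq_sym // pinchedC.
- by apply: (tri p s q); rewrite // 1?eq_sym // pinchedC.
- by apply: (tri q r s).
- by apply: (tri q s r); rewrite // 1?eq_sym // pinchedC.
- by apply: (tri r s q); rewrite // 1?eq_sym // pinchedC.
Qed.

Lemma pinched_K5_minus_triangle p q r s t :
  uniq [:: p; q; r; s; t] -> {subset [:: p; q; r; s; t] <= T} ->
  pinched p q -> pinched p r -> pinched p s -> pinched p t ->
  pinched q r -> pinched q s -> pinched q t -> False.
Proof.
move=> u sub pq pr ps pt qr qs qt.
have [pT qT] : p \in T /\ q \in T by split; apply: sub; rewrite !inE eqxx ?orbT.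
have [rT sT tT] : [/\ r \in T, s \in T & t \in T].
  by split; apply: sub; rewrite !inE eqxx ?orbT.
move: (u); rewrite /= !inE !negb_or.
case/and5P=> /and4P[npq npr nps npt] /and3P[nqr nqs nqt] _ _ _.
have nqp : q != p by rewrite eq_sym.
have tri x : p != x -> q != x -> x \in T -> pinched p x -> pinched q x ->
    [/\ linked p q, linked p x & linked q x].
  move=> px qx xT lpx lqx; have lqp : pinched q p by rewrite pinchedC.
  have xq : x != q by rewrite eq_sym.
  have xp : x != p by rewrite eq_sym.
  have lxq : pinched x q by rewrite pinchedC.
  have lxp : pinched x p by rewrite pinchedC.
  split; [apply: (@pinched_triangle p q x)|apply: (@pinched_triangle p x q)|apply: (@pinched_triangle q x p)];
  by rewrite //= !inE negb_or; apply/and3P; split=> //; apply/andP.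
have [l1 l2 l3] := tri r npr nqr rT pr qr.
have [_ l4 l5] := tri s nps nqs sT ps qs.
have [_ l6 l7] := tri t npt nqt tT pt qt.
exact: (linked_K5_minus_triangle u pT qT).
Qed.

(** Turns distinctness of terminals into a computation on their indices. *)
Lemma uniq_reindex (x0 : H) (l : seq H) (s : seq nat) : uniq l -> {subset l <= T} ->
    uniq s -> all (gtn (size l)) s ->
  uniq (map (nth x0 l) s) /\ {subset map (nth x0 l) s <= T}.
Proof.
move=> ul lT us /allP ls; split.
  by rewrite map_inj_in_uniq // => i j /ls il /ls jl /eqP; rewrite nth_uniq // => /eqP.
by move=> _ /mapP[i /ls il ->]; apply/lT/mem_nth.
Qed.

(** Suppose that no two disjoint pairs are unpinched.  If every pair is pinched, any four
    terminals contradict pinched_K4.  Otherwise take an unpinched pair {a, b}: all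
    pairs disjoint from it are pinched, so by pinched_K4 each of a and b lies
    in an unpinched pair with a further terminal, and it must be the same
    terminal x for both.  Hence the unpinched pairs form the triangle
    a, b, x, and pinched_K5_minus_triangle applies to the other two terminals. *)
Lemma pairing_of_independent : has_good_pairing H.
Proof.
have [/existsP[p /existsP[q /existsP[s /existsP[t /and4P[u /allP sub g1 g2]]]]]|none] := boolP
    [exists p, exists q, exists s, exists t,
      [&& uniq [:: p; q; s; t], all (mem T) [:: p; q; s; t], ~~ pinched p q & ~~ pinched s t]].
  by apply: (pairingI HP u sub); split=> // x y xT yT xy;
    have := indep xT yT; rewrite xy.
have N p q s t : uniq [:: p; q; s; t] /\ {subset [:: p; q; s; t] <= T} ->
    ~~ pinched p q -> pinched s t.
  move=> [u /allP sub] pq; apply: contraNT none => st.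
  apply/existsP; exists p; apply/existsP; exists q; apply/existsP; exists s.
  by apply/existsP; exists t; apply/and4P.
case: (boolP [exists a in T, exists b in T, (a != b) && ~~ pinched a b]); last first.
  move=> all_pinched; exfalso.
  have [[|a [|b [|c [|d [|e [|? ?]]]]]] //= _ [u ET]] :=
    @enum_terminals H HP [::] isT (fun x h => False_ind _ (notF h)).
  have lT : {subset [:: a; b; c; d; e] <= T} by move=> x; rewrite ET.
  have P x y : x \in T -> y \in T -> x != y -> pinched x y.
    move=> xT yT xy; apply: contraNT all_pinched => nxy.
    by apply/existsP; exists x; rewrite xT /=; apply/existsP; exists y; rewrite yT xy.
  have [u4 T4] := uniq_reindex a (l := [:: a; b; c; d; e]) u lT (s := [:: 0; 1; 2; 3]) isT isT.
  have [aT bT cT dT] : [/\ a \in T, b \in T, c \in T & d \in T].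
    by split; apply: T4; rewrite !inE eqxx ?orbT.
  move: (u4); rewrite /= !inE !negb_or => /and4P[/and3P[ab ac ad] /andP[bc bd] cd _].
  by apply: (pinched_K4 u4 T4); apply: P.
case/existsP=> a /andP[aT /existsP[b /and3P[bT ab pab]]].
have uab : uniq [:: a; b] by rewrite /= inE ab.
have sab : {subset [:: a; b] <= T} by apply/allP; rewrite /= aT bT.
have [[|c [|d [|e [|? ?]]]] //= _ [u ET]] := enum_terminals HP uab sab.
have lT : {subset [:: a; b; c; d; e] <= T} by move=> x; rewrite ET.
have R := uniq_reindex a (l := [:: a; b; c; d; e]) u lT.
have cd : pinched c d := N a b c d (R [:: 0; 1; 2; 3] isT isT) pab.
have ce : pinched c e := N a b c e (R [:: 0; 1; 2; 4] isT isT) pab.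
have de : pinched d e := N a b d e (R [:: 0; 1; 3; 4] isT isT) pab.
have outside x : x \in [:: c; d; e] -> [/\ x \in T, a != x & b != x].
  move=> xl; split; first by apply: lT; rewrite inE [_ || _]orbC inE xl orbT.
    case/andP: u => /memPn h _; rewrite eq_sym h // inE xl orbT //.
  by case/and3P: u => _ /memPn h _; rewrite eq_sym h.
have [x xl pax] : exists2 x, x \in [:: c; d; e] & ~~ pinched a x.
  apply/hasP; rewrite -[has _ _]negbK has_predC negbK; apply/negP=> /= /and4P[ac ad ae _].
  have [u4 T4] := R [:: 0; 2; 3; 4] isT isT.
  exact: (pinched_K4 u4 T4).
have [y yl pby] : exists2 y, y \in [:: c; d; e] & ~~ pinched b y.
  apply/hasP; rewrite -[has _ _]negbK has_predC negbK; apply/negP=> /= /and4P[bc bd be _].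
  have [u4 T4] := R [:: 1; 2; 3; 4] isT isT.
  exact: (pinched_K4 u4 T4).
have [[xT ax bx] [yT ay bY]] := (outside x xl, outside y yl).
have Exy : x = y.
  apply/eqP; apply: contraNT pby => xy; apply: (N a x) pax; split.
    by rewrite /= !inE !negb_or ax ab ay eq_sym bx xy bY.
  by apply/allP; rewrite /= aT xT bT yT.
subst y.
have uabx : uniq [:: a; b; x] by rewrite /= !inE negb_or ab ax bx.
have sabx : {subset [:: a; b; x] <= T} by apply/allP; rewrite /= aT bT xT.
have [[|f [|g [|? ?]]] //= _ [u' ET']] := enum_terminals HP uabx sabx.
have lT' : {subset [:: a; b; x; f; g] <= T} by move=> z; rewrite ET'.
have {}R := uniq_reindex a (l := [:: a; b; x; f; g]) u' lT'.
have [u5 T5] := R [:: 3; 4; 2; 0; 1] isT isT.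
exfalso; apply: (pinched_K5_minus_triangle u5 T5) => /=.
- exact: N (R [:: 0; 1; 3; 4] isT isT) pab.
- exact: N (R [:: 0; 1; 3; 2] isT isT) pab.
- exact: N (R [:: 1; 2; 3; 0] isT isT) pby.
- exact: N (R [:: 0; 2; 3; 1] isT isT) pax.
- exact: N (R [:: 0; 1; 4; 2] isT isT) pab.
- exact: N (R [:: 1; 2; 4; 0] isT isT) pby.
- exact: N (R [:: 0; 2; 4; 1] isT isT) pax.
Qed.

End NoAdjacentTerminals.

Lemma pole_pairing (H : mgraph) : pole H -> ~ is_cycle_graph H 5 -> has_good_pairing H.
Proof.
move=> HP nC.
have [/existsP[a /existsP[b /and3P[aT bT ab]]]|no] := boolP [exists a, exists b,
    [&& a \in terminals H, b \in terminals H & adj a b]].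
  exact: (pairing_of_adjacent HP nC aT bT ab).
apply: (pairing_of_independent HP) => s t sT tT; apply: contraNN no => st.
by apply/existsP; exists s; apply/existsP; exists t; apply/and3P.
Qed.

(** * The extension *)

Section Extension.
Variables (H : mgraph) (a1 a2 a3 a4 a5 : H).
Let K := extension a1 a2 a3 a4 a5.
Hypothesis HP : pole H.
Hypothesis uniq_a : uniq [:: a1; a2; a3; a4; a5].
Hypothesis terminals_a : terminals H =i [:: a1; a2; a3; a4; a5].
Hypothesis good12 : good_pair a1 a2.
Hypothesis good45 : good_pair a4 a5.
Local Notation T := (terminals H).
Implicit Types (X C : {set K}) (U : {set H}).

Let old (v : H) : K := inl v.
Let x : K := inr (@Ordinal 3 0 isT).
Let y : K := inr (@Ordinal 3 1 isT).
Let z : K := inr (@Ordinal 3 2 isT).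

(** All counts in the extension split into a count in H and seven explicit terms. *)
Lemma card_ext_edges (P : rel K) :
  #|[set e : edge K | P (src e) (tgt e)]| =
  #|[set e : edge H | P (old (src e)) (old (tgt e))]| +
  (P x y + (P y z + (P x (old a1) + (P x (old a2) + (P y (old a3) +
    (P z (old a4) + P z (old a5))))))).
Proof.
rewrite !card_set_sum big_sumType /=; congr (_ + _).
by rewrite !big_ord_recl big_ord0 addn0.
Qed.

Lemma ext_vertex (w : K) : [\/ exists v, w = old v, w = x, w = y | w = z].
Proof.
case: w => [v|[[|[|[|//]]] lt]]; first by constructor 1; exists v.
- by constructor 2; congr inr; apply: val_inj.
- by constructor 3; congr inr; apply: val_inj.
- by constructor 4; congr inr; apply: val_inj.
Qed.

Lemma card_setI_terminals U :
  #|U :&: T| = (a1 \in U) + ((a2 \in U) + ((a3 \in U) + ((a4 \in U) + (a5 \in U)))).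
Proof.
have -> : #|U :&: T| = count (mem U) [:: a1; a2; a3; a4; a5].
  rewrite -size_filter -(card_uniqP (filter_uniq (mem U) uniq_a)).
  by apply: eq_card => v; rewrite in_setI mem_filter terminals_a.
by rewrite /= addn0.
Qed.

Lemma extension_cubic : cubic K.
Proof.
move=> w; rewrite /deg.
have -> : #|[set e : edge K | src e == w]| = _ := card_ext_edges (fun u _ => u == w).
have -> : #|[set e : edge K | tgt e == w]| = _ := card_ext_edges (fun _ u => u == w).
have no_old (f : edge H -> H) (i : 'I_3) :
    #|[set e : edge H | old (f e) == inr i :> K]| = 0.
  by apply/eqP; rewrite cards_eq0; apply/eqP/setP=> e; rewrite !inE.
have [[v ->]|->|->|->] := ext_vertex w; last first.
- by rewrite !no_old.
- by rewrite !no_old.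
- by rewrite !no_old.
have Ev : ((a1 == v) + ((a2 == v) + ((a3 == v) + ((a4 == v) + (a5 == v)))) = (v \in T))%N.
  rewrite terminals_a -(count_uniq_mem _ uniq_a) /= addn0.
  by [].
have d2 := deg_ge2 HP v; have d3 := pole_deg HP v.
move: Ev; rewrite inE => Ev.
transitivity (deg v + ((deg v == 2) : nat)); last by case: eqP; lia.
have cs : #|[set e : edge H | old (src e) == old v]| = #|[set e : edge H | src e == v]| by [].
have ct : #|[set e : edge H | old (tgt e) == old v]| = #|[set e : edge H | tgt e == v]| by [].
rewrite -Ev cs ct /deg.
(* the zeros come from the ends x, y, z of new edges, which differ from v *)
by rewrite -[LHS]/(_ + (0 + (0 + (0 + (0 + (0 + (0 + 0)))))) + (_ + (0 + (0 + _)))) !addn0 !add0n addnA.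
Qed.

Let part X : {set H} := [set v | old v \in X].

Lemma ext_boundary X : #|boundary X| = #|boundary (part X)| +
  (((x \in X) != (y \in X)) + (((y \in X) != (z \in X)) + (((x \in X) != (a1 \in part X)) +
  (((x \in X) != (a2 \in part X)) + (((y \in X) != (a3 \in part X)) +
    (((z \in X) != (a4 \in part X)) + ((z \in X) != (a5 \in part X)))))))).
Proof.
rewrite /boundary (card_ext_edges (fun u v => (u \in X) != (v \in X))) !inE.
by congr (#|pred_of_set _| + _); apply/setP=> e; rewrite !inE.
Qed.

Lemma cyclic_set_part X : x \notin X -> y \notin X -> z \notin X ->
  cyclic_set X -> cyclic_set (part X).
Proof.
move=> xX yX zX [C sCX /andP[C0 leC]].
have EC : C = old @: part C.
  apply/setP=> w; apply/idP/imsetP=> [wC|[v + ->]]; last by rewrite inE.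
  have wX := subsetP sCX w wC.
  case: (ext_vertex w) => [[v Ew]|Ew|Ew|Ew]; [|by rewrite Ew in wX; move: wX xX yX zX => ->..].
  by exists v; rewrite ?inE -?Ew.
exists (part C); first by apply/subsetP=> v; rewrite !inE; apply: (subsetP sCX).
have <- : #|C| = #|part C| by rewrite {1}EC card_imset // => u v [].
rewrite C0 (leq_trans leC) //.
have xC : (x \in C) = false by apply: contraNF xX; apply: (subsetP sCX).
have yC : (y \in C) = false by apply: contraNF yX; apply: (subsetP sCX).
have zC : (z \in C) = false by apply: contraNF zX; apply: (subsetP sCX).
rewrite /inner (card_ext_edges (fun u v => (u \in C) && (v \in C))) xC yC zC /= !addn0.
by apply: subset_leq_card; apply/subsetP=> e; rewrite !inE.
Qed.

Lemma prune_new X (w : K) : w \in [:: x; y; z] ->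
  #|[set e : edge K | (src e \in X) && (tgt e \in X) && ((src e == w) || (tgt e == w))]| <= 1 ->
  cyclic_set X -> cyclic_set (X :\ w).
Proof.
move=> wn le1; apply: cyclic_setD1.
  apply: leq_trans le1; apply: subset_leq_card; apply/subsetP=> e.
  by rewrite !inE.
apply/eqP; rewrite -cards_eq0 /inner (card_ext_edges (fun u v => (u \in [set w]) && (v \in [set w]))).
rewrite (_ : [set e : edge H | _] = set0) ?cards0; last first.
  by apply/setP=> e; rewrite !inE; move: wn; rewrite !inE => /or3P[]/eqP ->.
by rewrite !inE; move: wn; rewrite !inE => /or3P[]/eqP ->.
Qed.

Lemma part_setD1 X (w : K) : w \in [:: x; y; z] -> part (X :\ w) = part X.
Proof.
by move=> wn; apply/setP=> v; rewrite !inE; move: wn; rewrite !inE => /or3P[]/eqP ->.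
Qed.

Lemma no_old_incidence X (w : K) : w \in [:: x; y; z] ->
  #|[set e : edge H | (old (src e) \in X) && (old (tgt e) \in X) &&
      ((old (src e) == w) || (old (tgt e) == w))]| = 0.
Proof.
move=> wn; apply/eqP; rewrite cards_eq0; apply/eqP/setP=> e; rewrite !inE.
by move: wn; rewrite !inE => /or3P[]/eqP ->; rewrite andbF.
Qed.

Lemma prune_x X : (y \in X) + ((a1 \in part X) + (a2 \in part X)) <= 1 ->
  cyclic_set X -> cyclic_set (X :\ x).
Proof.
rewrite !inE => le1; apply: prune_new => //.
rewrite (card_ext_edges (fun u v => (u \in X) && (v \in X) && ((u == x) || (v == x)))).
rewrite no_old_incidence // add0n /= ?andbT ?andbF /= ?addn0.
by apply: leq_trans le1; case: (x \in X) => //=.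
Qed.

Lemma prune_y X : (x \in X) + ((z \in X) + (a3 \in part X)) <= 1 ->
  cyclic_set X -> cyclic_set (X :\ y).
Proof.
rewrite !inE => le1; apply: prune_new => //.
rewrite (card_ext_edges (fun u v => (u \in X) && (v \in X) && ((u == y) || (v == y)))).
rewrite no_old_incidence // add0n /= ?andbT ?andbF /= ?addn0.
by apply: leq_trans le1; case: (y \in X) => //=; rewrite ?andbT ?andbF.
Qed.

Lemma prune_z X : (y \in X) + ((a4 \in part X) + (a5 \in part X)) <= 1 ->
  cyclic_set X -> cyclic_set (X :\ z).
Proof.
rewrite !inE => le1; apply: prune_new => //.
rewrite (card_ext_edges (fun u v => (u \in X) && (v \in X) && ((u == z) || (v == z)))).
rewrite no_old_incidence // add0n /= ?andbT ?andbF /= ?addn0.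
by apply: leq_trans le1; case: (z \in X) => //=; rewrite ?andbT ?andbF.
Qed.

Lemma cyclic_boundary U : cyclic_set U -> 5 <= #|boundary U| + #|U :&: T|.
Proof.
by move=> cU; have := pole_sparse HP cU; have := pole_count HP U; lia.
Qed.

Lemma cyclic_set_neq0 U : cyclic_set U -> U != set0.
Proof.
by case=> C sCU /andP[C0 _]; apply: contraTneq sCU => ->; rewrite subset0 -cards_eq0 -lt0n.
Qed.

(** If U has no terminal besides p and q, this is the first clause of good_pair.  With
    three terminals in U, a boundary of at most 2 edges would leave a
    complement of two adjacent terminals, against the second clause.  With
    more, boundary_ge3 applied to the complement suffices. *)
Lemma good_pair_bound U p q : p != q -> p \in T -> q \in T -> good_pair p q ->
  p \in U -> q \in U -> ~: U != set0 -> 6 <= #|boundary U| + #|U :&: T|.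
Proof.
move=> pq pT qT [npin meets] pU qU U0.
have c2 : #|[set p; q]| = 2 by rewrite cards2 pq.
have sub : [set p; q] \subset U :&: T.
  by apply/subsetP=> v; rewrite in_set2 in_setI => /orP[]/eqP ->; rewrite ?pU ?qU.
have ge2 : 2 <= #|U :&: T| by rewrite -c2 subset_leq_card.
have sum5 : #|~: U :&: T| + #|U :&: T| = 5.
  have := card_compl_terminals HP U; have := subset_leq_card (subsetIr U T).
  by rewrite (card_terminals HP); lia.
have ge3 := boundary_ge3 HP U0; rewrite boundaryC in ge3.
have [E2|E2|E3] := ltngtP #|U :&: T| 2; first by move: E2 ge2; clear; lia.
  have [le3|gt3] := leqP #|U :&: T| 3; last by move: gt3 sum5 ge3; clear; lia.
  have E3 : #|U :&: T| = 3 by move: E2 le3; clear; lia.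
  rewrite E3 in sum5 *; rewrite leqNgt; apply/negP=> lt6.
  have W2 : #|~: U :&: T| = 2 by move: sum5; clear; lia.
  have le2 : #|~: U| <= 2.
    by apply: (small_boundary HP); rewrite boundaryC W2; move: lt6; clear; lia.
  have WT : ~: U :&: T = ~: U by apply/eqP; rewrite eqEcard subsetIl W2.
  rewrite WT in W2; have /cards2P[s [t [st EW]]] : #|~: U| == 2 by rewrite W2.
  have [sW tW] : s \in ~: U /\ t \in ~: U by rewrite EW !inE !eqxx orbT.
  have [sT tT] : s \in T /\ t \in T by split; apply: (subsetP (introT setIidPl WT)).
  have ast : adj s t.
    apply: (inner2 HP st); rewrite -EW.
    have := pole_count HP (~: U); rewrite WT W2 boundaryC; move: lt6; clear; lia.
  rewrite !in_setC in sW tW.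
  have := meets s t sT tT ast; rewrite !inE.
  by case/orP=> /orP[]/eqP E; [move: sW|move: sW|move: tW|move: tW]; rewrite E ?pU ?qU.
have UT : U :&: T = [set p; q] by apply/eqP; rewrite eq_sym eqEcard sub E3 c2.
rewrite E3; suff : 3 < #|boundary U| by clear; lia.
rewrite ltnNge; apply: contra npin => le3.
by apply/existsP; exists U; rewrite UT eqxx.
Qed.

(** The new vertices alone span a path. *)
Lemma cyclic_set_part_neq0 X : cyclic_set X -> part X != set0.
Proof.
move=> cX; apply/negP=> /eqP P0.
have [xn yn zn] : [/\ x \in [:: x; y; z], y \in [:: x; y; z] & z \in [:: x; y; z]] by [].
have c1 : cyclic_set (X :\ z).
  by apply: prune_z cX; rewrite P0 !in_set0; case: (y \in X).
have c2 : cyclic_set (X :\ z :\ x).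
  apply: prune_x c1; rewrite part_setD1 // P0 !in_set0.
  by case: (y \in _).
have c3 : cyclic_set (X :\ z :\ x :\ y).
  by apply: prune_y c2; rewrite !part_setD1 // P0 !inE.
have c4 : cyclic_set (part (X :\ z :\ x :\ y)) by apply: cyclic_set_part c3; rewrite !inE.
by have := cyclic_set_neq0 c4; rewrite !part_setD1 // P0 eqxx.
Qed.

(** A new vertex with at most one neighbour in X can be dropped, which leaves a cyclic set
    of vertices of H.  This fails only if X contains x, a1, a2 or z, a4, a5, and
    there good_pair_bound gives the bound directly. *)
Lemma half_boundary X : (x \in X) + ((y \in X) + (z \in X)) <= 1 ->
  cyclic_set X -> cyclic_set (~: X) -> 5 <= #|boundary X|.
Proof.
move=> le1 cX cX'.
have [T1 T2 T3 T4 T5] : [/\ a1 \in T, a2 \in T, a3 \in T, a4 \in T & a5 \in T].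
  by split; rewrite terminals_a !inE eqxx ?orbT.
have [n12 n45] : a1 != a2 /\ a4 != a5.
  move: uniq_a; rewrite /= !inE !negb_or.
  by case/and5P=> /and4P[-> _ _ _] _ _ -> _.
have xn : x \in [:: x; y; z] by [].
have yn : y \in [:: x; y; z] by [].
have zn : z \in [:: x; y; z] by [].
have cU (Y : {set K}) w : w \in [:: x; y; z] ->
    {in [:: x; y; z], forall u, u != w -> u \notin Y} ->
    cyclic_set (Y :\ w) -> cyclic_set (part Y).
  move=> wn nY cY; rewrite -(part_setD1 _ wn).
  have out u : u \in [:: x; y; z] -> u \notin Y :\ w.
    by move=> un; rewrite in_setD1 negb_and negbK; case: eqP => //= /eqP; apply: nY.
  by apply: cyclic_set_part cY; apply: out.
have partC : part (~: X) = ~: part X by apply/setP=> v; rewrite !inE.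
have Un0 : ~: part X != set0 by rewrite -partC cyclic_set_part_neq0.
have := ext_boundary X; have := card_setI_terminals (part X).
have := good_pair_bound n12 T1 T2 good12 (U := part X).
have := good_pair_bound n45 T4 T5 good45 (U := part X).
have := @cyclic_boundary (part X).
have px := @prune_x X; have py := @prune_y X; have pz := @prune_z X.
have ux := cU X x xn; have uy := cU X y yn; have uz := cU X z zn.
have u0 := @cyclic_set_part X.
move: px py pz ux uy uz u0 le1.
have split3 (P : K -> Prop) : P x -> P y -> P z -> {in [:: x; y; z], forall u, P u}.
  by move=> Px Py Pz u; rewrite !inE => /or3P[]/eqP ->.
case xX: (x \in X); case yX: (y \in X); case zX: (z \in X) => //=.
- move=> px _ _ ux _ _ _ _.
  have {}ux : cyclic_set (X :\ x) -> cyclic_set (part X).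
    by apply: ux; apply: split3; rewrite ?eqxx // ?yX ?zX.
  have [|] := boolP ((a1 \in part X) && (a2 \in part X)).
    case/andP=> -> -> _ _ /(_ isT isT Un0).
    by case: (a3 \in _); case: (a4 \in _); case: (a5 \in _); clear; lia.
  move=> n12' cb _ _ Et Eb.
  have {}cb : 5 <= #|boundary (part X)| + #|part X :&: T|.
    apply/cb/ux/px => //; by move: n12'; case: (a1 \in _); case: (a2 \in _).
  by move: n12' Et Eb cb; case: (a1 \in _); case: (a2 \in _); case: (a3 \in _);
    case: (a4 \in _); case: (a5 \in _) => //; clear; lia.
- move=> _ py _ _ uy _ _ _ cb _ _ Et Eb.
  have {}cb : 5 <= #|boundary (part X)| + #|part X :&: T|.
    apply/cb/uy/py => //; last by case: (a3 \in _).
    by apply: split3; rewrite ?eqxx // ?xX ?zX.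
  by move: Et Eb cb; case: (a1 \in _); case: (a2 \in _); case: (a3 \in _);
    case: (a4 \in _); case: (a5 \in _) => //; clear; lia.
- move=> _ _ pz _ _ uz _ _.
  have {}uz : cyclic_set (X :\ z) -> cyclic_set (part X).
    by apply: uz; apply: split3; rewrite ?eqxx // ?xX ?yX.
  have [|] := boolP ((a4 \in part X) && (a5 \in part X)).
    case/andP=> -> -> _ /(_ isT isT Un0) b _; move: b.
    by case: (a1 \in _); case: (a2 \in _); case: (a3 \in _); clear; lia.
  move=> n45' cb _ _ Et Eb.
  have {}cb : 5 <= #|boundary (part X)| + #|part X :&: T|.
    apply/cb/uz/pz => //; by move: n45'; case: (a4 \in _); case: (a5 \in _).
  by move: n45' Et Eb cb; case: (a1 \in _); case: (a2 \in _); case: (a3 \in _);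
    case: (a4 \in _); case: (a5 \in _) => //; clear; lia.
- move=> _ _ _ _ _ _ u0 _ cb _ _ Et Eb.
  have {}cb : 5 <= #|boundary (part X)| + #|part X :&: T| by apply/cb/u0.
  by move: Et Eb cb; case: (a1 \in _); case: (a2 \in _); case: (a3 \in _);
    case: (a4 \in _); case: (a5 \in _) => //; clear; lia.
Qed.

(** Either X or its complement contains at most one of x, y, z. *)
Lemma extension_cyclic_boundary X : cyclic_set X -> cyclic_set (~: X) -> 5 <= #|boundary X|.
Proof.
move=> cX cX'.
have [le1|gt1] := leqP ((x \in X) + ((y \in X) + (z \in X))) 1; first exact: half_boundary.
rewrite -boundaryC; apply: half_boundary => //; last by rewrite setCK.
by move: gt1; rewrite !in_setC; do 3 case: (_ \in X).
Qed.

(** A connectivity class with empty boundary contains all of x, y, z and the terminals or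
    none; by boundary_ge3 a nonempty set of vertices of H with empty boundary
    contains terminals. *)
Lemma extension_connected : connected K.
Proof.
split; first by apply/card_gt0P; exists x.
move=> u v; pose X := [set w | connect (@adj K) u w].
have uX : u \in X by rewrite inE connect0.
have sym : connect_sym (@adj K) by apply: sym_connect_sym; apply: adjC.
have b0 : boundary X = set0.
  apply/setP=> e; rewrite !inE; apply/negbTE; rewrite negbK; apply/eqP.
  apply: same_connect_r => //; apply: connect1; apply/existsP; exists e.
  by rewrite !eqxx.
suff : v \in X by rewrite inE.
have /esym/eqP := ext_boundary X; rewrite b0 cards0 !addn_eq0 !eqb0 !negbK.
case/and4P=> /eqP bU /eqP Exy /eqP Eyz /and5P[/eqP E1 /eqP E2 /eqP E3 /eqP E4 /eqP E5].
have tU := card_setI_terminals (part X); have cT := card_compl_terminals HP (part X).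
rewrite -E1 -E2 -E3 -E4 -E5 -Eyz -Exy in tU.
have inner_part w : (old w \in X) = (w \in part X) by rewrite [RHS]in_set.
case xX: (x \in X) Exy Eyz tU => yX; rewrite -yX => zX tU.
  have [[w ->]|->|->|->] := ext_vertex v; rewrite -?yX -?zX //.
  rewrite inner_part; apply: contraT => wU.
  have /(boundary_ge3 HP) : ~: part X != set0 by apply/set0Pn; exists w; rewrite inE.
  by rewrite boundaryC bU; move: cT; rewrite tU; clear; lia.
have [[w Ew]|Eu|Eu|Eu] := ext_vertex u; try by rewrite Eu ?xX -?yX -?zX in uX.
rewrite Ew inner_part in uX.
have /(boundary_ge3 HP) : part X != set0 by apply/set0Pn; exists w.
by rewrite bU tU.
Qed.

Lemma extension_cyclically_connected : cyclically_connected K 5.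
Proof.
apply: cyclically_connectedI extension_connected _ => X.
exact: extension_cyclic_boundary.
Qed.

End Extension.

Theorem theorem9 (G H : mgraph)
  (Gconn : connected G) (Gcubic : cubic G)
  (Gzeta : cyclic_connectivity_is G 5)
  (Hpart : cyclic_part G H)
  (HnotC5 : ~ is_cycle_graph H 5) :
  exists a1 a2 a3 a4 a5 : H,
    [/\ uniq [:: a1; a2; a3; a4; a5],
        forall v : H, (v \in [:: a1; a2; a3; a4; a5]) = (deg v == 2),
        cubic (extension a1 a2 a3 a4 a5)
      & cyclically_connected (extension a1 a2 a3 a4 a5) 5].
Proof.
have HP := cyclic_part_pole Gconn Gcubic Gzeta Hpart.
have [a1 [a2 [a3 [a4 [a5 [u ET g12 g45]]]]]] := pole_pairing HP HnotC5.
exists a1, a2, a3, a4, a5; split=> //.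
- by move=> v; rewrite -ET inE.
- exact: extension_cubic.
- exact: extension_cyclically_connected.
Qed.
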